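(* Let $\beta$ be a braid with closure $\mathcal{L}_\beta\subset S^3$, let $w_\beta$ be its writhe, and let $\{\widehat\beta\}_\circ$ be the associated linear combination of collections of labeled essential circles in the annulus (see context). Let $\{\widehat\beta\}_\circ|_{q\leftrightarrow q^{-1}}$ be the result of substituting $q^{-1}$ for $q$ in the coefficients. Then: (1) for every $n\ge1$, $P_n(\mathcal{L}_\beta)$ is equal to $(-1)^{w_\beta}q^{n w_\beta}$ times the element obtained from $\{\widehat\beta\}_\circ|_{q\leftrightarrow q^{-1}}$ by assigning to each $k$-labeled circle the value ${n\brack k}$ (multiplicatively over the circles of a collection); (2) $P_\infty(\mathcal{L}_\beta)$ is equal to $(-1)^{w_\beta}a^{w_\beta}$ times the element obtained from $\{\widehat\beta\}_\circ|_{q\leftrightarrow q^{-1}}$ by assigning to each $k$-labeled circle the value $$\mathsf{c}_{\wedge^k}:=q^{k^2}a^{-k}\prod_{i=1}^k\frac{1-a^2q^{2-2i}}{1-q^{2i}} .$$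
   Context: $[k]=\frac{q^k-q^{-k}}{q-q^{-1}}$ are quantum integers and ${k\brack l}$ are quantum binomial coefficients. Webs. A (braid-like) web is an upward-directed planar trivalent graph in a strip, with edges labeled by positive integers, built from merges $(k,l)\to k+l$ and splits $k+l\to(k,l)$. Its annular closure is a web in the annulus. Webs are taken up to isotopy and modulo the $\mathbb{Z}[q,q^{-1}]$-linear local relations (and those obtained from these by symmetry or by reversing all orientations): (i) associativity: the two ways of merging $(k,l,p)$ to $k+l+p$ are equal; (ii) digon removal: $k{+}l\to(k,l)\to k{+}l$ equals ${k+l\brack l}$ times the identity strand; (iii) square relation: on strands $(k,l)$, the web moving a $1$-labeled edge from the left strand to the right strand and then a $1$-labeled edge back, minus the web moving a $1$-labeled edge from the right strand to the left and then one back, equals $[k-l]$ times the identity. Bracket. For a braid $\beta$ (strands directed upward, labeled $1$), $\{\beta\}$ is obtained by replacing each positive crossing (over-strand going from bottom left to top right) by $-q\,\mathrm{Id}+E$ and each negative crossing by $E-q^{-1}\mathrm{Id}$, where $\mathrm{Id}$ is two parallel strands and $E$ is the web $(1,1)\to 2\to(1,1)$. The writhe $w_\beta$ is the number of positive minus the number of negative crossings. $\{\widehat\beta\}$ is the annular closure. Using only relations (i)–(iii) (and their symmetric versions) the annular closure of every braid-like web can be written as a $\mathbb{Z}[q,q^{-1}]$-linear combination of collections of concentric essential circles labeled by positive integers; the resulting expression of $\{\widehat\beta\}$ is denoted $\{\widehat\beta\}_\circ$, and it is unique once the labels are required to be radially non-decreasing. Link polynomials. $P_n$ is the (uncolored,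 framing-independent) $\mathfrak{sl}_n$ Reshetikhin–Turaev polynomial, satisfying $q^{-n}P_n(L_+)-q^{n}P_n(L_-)=(q^{-1}-q)P_n(L_0)$ with value $[n]$ on the unknot. $P_\infty$ is the HOMFLYPT polynomial, the unique link invariant with $a^{-1}P_\infty(L_+)-aP_\infty(L_-)=(q^{-1}-q)P_\infty(L_0)$ and value $\frac{a-a^{-1}}{q-q^{-1}}$ on the unknot. Here $L_\pm$ have a positive/negative crossing and $L_0$ its oriented resolution. *)

(* Defs.v *)
From HB Require Import structures.
From mathcomp Require Import all_boot all_order all_algebra.
From mathcomp Require Import generic_quotient.
From mathcomp Require Import finmap.
From mathcomp.multinomials Require Import monalg.

Set Implicit Arguments.
Unset Strict Implicit.
Unset Printing Implicit Defensive.

Import Order.TTheory GRing.Theory Num.Theory.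
Local Open Scope ring_scope.
Local Open Scope quotient_scope.

(* Coefficients: Z[q, q^-1] is viewed inside its fraction field Q(q), and the
   HOMFLYPT polynomial takes its values in Q(q)(a). *)

Definition Qq : fieldType := {fraction {poly int}}.
Definition q : Qq := tofrac 'X.

Definition Qqa : fieldType := {fraction {poly Qq}}.
Definition toQqa (c : Qq) : Qqa := tofrac c%:P.
Definition a : Qqa := tofrac 'X.

Definition laurent (c : Qq) : Prop :=
  exists (p : {poly int}) (e : nat), c = tofrac p / q ^+ e.

Definition evalV (p : {poly int}) : Qq := (map_poly intr p).[q^-1].

(* The substitution q <-> q^-1, computed on a representing fraction; [evalV] is
   injective, so the choice of the fraction is irrelevant, see [qbar_frac]. *)
Definition qbar (c : Qq) : Qq :=
  let f := repr c in evalV (\n_f) / evalV (\d_f).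

Definition qint (k : int) : Qq := (q ^ k - q ^ (- k)) / (q - q^-1).

Definition qbinom (n k : nat) : Qq :=
  \prod_(i < k) (qint (n%:Z - i%:Z) / qint i.+1%:Z).

Lemma q_neq0 : q != 0.
Proof. by rewrite /q tofrac_eq0 polyX_eq0. Qed.

Lemma evalV_eq0 (p : {poly int}) : (evalV p == 0) = (p == 0).
Proof.
apply/eqP/eqP => [|->]; last by rewrite /evalV rmorph0 horner0.
set n := size p => p0.
have : tofrac (\poly_(i < n) p`_(n.-1 - i)) = evalV p * q ^+ n.-1.
  rewrite /evalV horner_coef size_map_inj_poly ?rmorph0 //; last first.
    move=> x y /eqP; rewrite -subr_eq0 -rmorphB /= => /eqP.
    have -> : (x - y)%:~R = tofrac (x - y)%:P :> Qq.
      by rewrite -[in RHS](intz (x - y)) rmorph_int rmorph_int.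
    by move/eqP; rewrite tofrac_eq0 polyC_eq0 subr_eq0 => /eqP.
  rewrite poly_def rmorph_sum mulr_suml (reindex_inj rev_ord_inj) /=.
  apply: eq_bigr => i _; rewrite coef_map /= -/n.
  have in1 : (i <= n.-1)%N by case: n i => [[]//|n i]; rewrite -ltnS.
  have -> : (n - i.+1 = n.-1 - i)%N by rewrite subnS -predn_sub.
  rewrite subKn // -mul_polyC rmorphM rmorphXn /= -/q.
  have -> : tofrac (p`_i)%:P = (p`_i)%:~R :> Qq.
    by rewrite -[in LHS](intz p`_i) rmorph_int rmorph_int.
  rewrite -mulrA; congr (_ * _).
  by rewrite exprVn -{2}(subnK in1) exprD mulrCA mulVf ?mulr1 // expf_neq0 ?q_neq0.
rewrite p0 mul0r => /eqP; rewrite tofrac_eq0 => /eqP /polyP r0.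
apply/polyP => i; rewrite coef0; case: (ltnP i n) => [lt_in | /(nth_default 0) //].
have := r0 (n.-1 - i)%N; rewrite coef_poly coef0.
case: ltnP => [_|]; first by rewrite subKn // -ltnS prednK // (leq_ltn_trans _ lt_in).
by rewrite leqNgt (leq_ltn_trans (leq_subr _ _)) // prednK // (leq_ltn_trans _ lt_in).
Qed.

Lemma qbar_frac (p r : {poly int}) :
  r != 0 -> qbar (tofrac p / tofrac r) = evalV p / evalV r.
Proof.
move=> r0; rewrite /qbar; set c : Qq := tofrac p / tofrac r; set f := repr c.
have d0 : \d_f != 0 by exact: denom_ratioP.
have fE : c * tofrac \d_f = tofrac \n_f.
  rewrite -[c]reprK -/f; unlock FracField.tofrac.
  rewrite -[LHS]FracField.pi_mul; apply/eqmodP.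
  rewrite /= FracField.equivfE /FracField.mulf !numden_Ratio ?mulr1 ?oner_neq0 //.
  by rewrite mulrC.
have evM : {morph evalV : x y / x * y}.
  by move=> x y; rewrite /evalV rmorphM hornerM.
have /(congr1 evalV) : \n_f * r = p * \d_f.
  by apply/eqP; rewrite -tofrac_eq !tofracM -fE /c mulrAC divfK ?tofrac_eq0.
by rewrite !evM => e; apply/eqP; rewrite eqr_div ?evalV_eq0 // e.
Qed.

(* Diagrams in general position with respect to the height function. [O] labels
   the strands, [G] is the set of elementary pieces, and a layer (s, g, t) is
   the piece g with vertical strands s to its left and t to its right. A diagram
   is the list of its layers, read from bottom to top. *)

Section Layers.
Variables (O : eqType) (G : Type) (dom cod : G -> seq O).

Definition layer : Type := (seq O * G * seq O)%type.
Definition bottom (l : layer) : seq O := l.1.1 ++ dom l.1.2 ++ l.2.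
Definition top (l : layer) : seq O := l.1.1 ++ cod l.1.2 ++ l.2.

Fixpoint is_diagram (x : seq O) (w : seq layer) (y : seq O) : bool :=
  if w is l :: w' then (x == bottom l) && is_diagram (top l) w' y else x == y.

Variant height_exchange : seq layer -> seq layer -> Prop :=
  HeightExchange s g m h t : height_exchange
    [:: (s, g, m ++ dom h ++ t); (s ++ cod g ++ m, h, t)]
    [:: (s ++ dom g ++ m, h, t); (s, g, m ++ cod h ++ t)].

Lemma is_diagram_cat x u y v z :
  is_diagram x u y -> is_diagram y v z -> is_diagram x (u ++ v) z.
Proof.
elim: u x => [|l u IHu] x /=; first by move/eqP->.
by case/andP=> -> /IHu/[apply].
Qed.

End Layers.

(* Oriented link diagrams. The strands are labelled by their direction at the
   given height, [true] for upward. In [Crossing b o1 o2] the strands with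
   directions o1 (bottom left) and o2 (bottom right) cross, and the over-strand
   goes from bottom left to top right iff b. *)

Variant tangle : Type :=
  | Cup of bool
  | Cap of bool
  | Crossing of bool & bool & bool.

Definition tdom (g : tangle) : seq bool :=
  match g with
  | Cup _ => [::]
  | Cap o => [:: o; ~~ o]
  | Crossing _ o1 o2 => [:: o1; o2]
  end.

Definition tcod (g : tangle) : seq bool :=
  match g with
  | Cup o => [:: o; ~~ o]
  | Cap _ => [::]
  | Crossing _ o1 o2 => [:: o2; o1]
  end.

Notation tangle_diagram := (is_diagram tdom tcod).

Record link_diagram := LinkDiagram {
  link_layers :> seq (layer bool tangle);
  link_closed : tangle_diagram [::] link_layers [::]
}.

(* Planar isotopies and Reidemeister moves between diagrams in general position
   with respect to the height function: two oriented link diagrams present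
   isotopic links in S^3 iff they are related by these local moves. In
   [Reidemeister3], bij tells whether strand i is above strand j (strands being
   numbered from left to right at the bottom); the condition says that the
   heights of the three strands are linearly ordered. *)
Variant isotopy_move : seq (layer bool tangle) -> seq (layer bool tangle) -> Prop :=
  | TangleExchange A B of height_exchange tdom tcod A B : isotopy_move A B
  | ZigzagL s o t : isotopy_move
      [:: (s ++ [:: o], Cup (~~ o), t); (s, Cap o, o :: t)] [::]
  | ZigzagR s o t : isotopy_move
      [:: (s, Cup o, o :: t); (s ++ [:: o], Cap (~~ o), t)] [::]
  | SlideCap s b o p t : isotopy_move
      [:: (s, Crossing b o p, ~~ o :: t); (s ++ [:: p], Cap o, t)]
      [:: (s ++ [:: o], Crossing (~~ b) p (~~ o), t); (s, Cap o, p :: t)]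
  | SlideCup s b o p t : isotopy_move
      [:: (s ++ [:: p], Cup o, t); (s, Crossing b p o, ~~ o :: t)]
      [:: (s, Cup o, p :: t); (s ++ [:: o], Crossing (~~ b) (~~ o) p, t)]
  | Reidemeister1Cap s b o t : isotopy_move
      [:: (s, Crossing b (~~ o) o, t); (s, Cap o, t)] [:: (s, Cap (~~ o), t)]
  | Reidemeister1Cup s b o t : isotopy_move
      [:: (s, Cup o, t); (s, Crossing b o (~~ o), t)] [:: (s, Cup (~~ o), t)]
  | Reidemeister2 s b o1 o2 t : isotopy_move
      [:: (s, Crossing b o1 o2, t); (s, Crossing (~~ b) o2 o1, t)] [::]
  | Reidemeister3 s b12 b13 b23 o1 o2 o3 t of (b12 == b23) ==> (b13 == b12) :
      isotopy_move
      [:: (s, Crossing b12 o1 o2, o3 :: t); (s ++ [:: o2], Crossing b13 o1 o3, t);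
          (s, Crossing b23 o2 o3, o1 :: t)]
      [:: (s ++ [:: o1], Crossing b23 o2 o3, t); (s, Crossing b13 o1 o3, o2 :: t);
          (s ++ [:: o3], Crossing b12 o1 o2, t)].

Definition link_invariant (K : Type) (P : link_diagram -> K) : Prop :=
  forall (u v A B : seq (layer bool tangle)) (D D' : link_diagram),
    isotopy_move A B -> link_layers D = u ++ A ++ v ->
    link_layers D' = u ++ B ++ v -> P D = P D'.

(* x P(L+) - y P(L-) = z P(L0); by a planar isotopy both strands at the crossing
   can be assumed to be directed upward, as required here. *)
Definition skein_relation (K : nzRingType) (x y z : K) (P : link_diagram -> K) :=
  forall (u v : seq (layer bool tangle)) (s t : seq bool)
         (Lpos Lneg Lres : link_diagram),
    link_layers Lpos = u ++ [:: (s, Crossing true true true, t)] ++ v ->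
    link_layers Lneg = u ++ [:: (s, Crossing false true true, t)] ++ v ->
    link_layers Lres = u ++ v ->
    x * P Lpos - y * P Lneg = z * P Lres.

Definition unknot : link_diagram :=
  @LinkDiagram [:: ([::], Cup true, [::]); ([::], Cap true, [::])] isT.

Definition is_sln_polynomial (n : nat) (P : link_diagram -> Qq) : Prop :=
  [/\ link_invariant P,
      skein_relation (q ^- n) (q ^+ n) (q^-1 - q) P &
      P unknot = qint n].

Definition is_homflypt (P : link_diagram -> Qqa) : Prop :=
  [/\ link_invariant P,
      skein_relation a^-1 a (toQqa (q^-1 - q)) P &
      P unknot = (a - a^-1) / toQqa (q - q^-1)].

(* The letter (i, b) of a braid word on N strands is the crossing of the strands
   at positions i and i + 1, positive iff b. *)
Definition braid (N : nat) : Type := seq ('I_N.-1 * bool).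

Definition writhe N (beta : braid N) : int :=
  (count snd beta)%:Z - (count (predC snd) beta)%:Z.

(* The closing strands run to the left of the braid. *)
Definition closure_layers N (beta : braid N) : seq (layer bool tangle) :=
  [seq (nseq j false, Cup false, nseq j true) | j <- iota 0 N] ++
  [seq (nseq N false ++ nseq c.1 true, Crossing c.2 true true,
        nseq (N - c.1.+2) true) | c : 'I_N.-1 * bool <- beta] ++
  [seq (nseq j false, Cap false, nseq j true) | j <- rev (iota 0 N)].

Lemma closure_closed N (beta : braid N) :
  tangle_diagram [::] (closure_layers beta) [::].
Proof.
have nseqS (b : bool) (j : nat) r : nseq j b ++ b :: r = nseq j.+1 b ++ r.
  by elim: j => //= j ->.
pose F j := nseq j false ++ nseq j true.
have FE j : nseq j false ++ [:: false; true] ++ nseq j true = F j.+1.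
  by rewrite /F -nseqS.
apply: (@is_diagram_cat _ _ _ _ _ _ (F N)).
  have cups M k : tangle_diagram (F k)
      [seq (nseq j false, Cup false, nseq j true) | j <- iota k M] (F (k + M)%N).
    elim: M k => [|M IHM] k /=; first by rewrite addn0.
    by rewrite eqxx /top /= FE addnS -addSn.
  exact: (cups N 0%N).
apply: (@is_diagram_cat _ _ _ _ _ _ (F N)).
  elim: beta => [|[i b] beta IH] /=; first exact: eqxx.
  have iE : F N = (nseq N false ++ nseq i true) ++ [:: true; true]
                  ++ nseq (N - i.+2) true.
    rewrite /F -catA; congr (_ ++ _); rewrite -[[:: true; true]]/(nseq 2 true).
    rewrite -!nseqD; congr nseq; case: i => i /=; case: N {beta IH} => // n.
    by case: n => // n; rewrite /= ltnS => lin; rewrite add2n addnS addnS subSS subSS subnKC.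
  by rewrite /bottom /top /= -iE eqxx.
elim: N {beta} => [|N IHN] //; rewrite -addn1 iotaD rev_cat map_cat /=.
by rewrite addn1 /bottom /top /= FE eqxx.
Qed.

Definition braid_closure N (beta : braid N) : link_diagram :=
  LinkDiagram (closure_closed beta).

(* Braid-like webs. [Merge k l] is k, l -> k + l and [Split k l] is
   k + l -> k, l. *)

Variant vertex : Type :=
  | Merge of nat & nat
  | Split of nat & nat.

Definition vertex_code (g : vertex) : nat * nat + nat * nat :=
  match g with Merge k l => inl (k, l) | Split k l => inr (k, l) end.
Definition vertex_decode (c : nat * nat + nat * nat) : vertex :=
  match c with inl (k, l) => Merge k l | inr (k, l) => Split k l end.
Lemma vertex_codeK : cancel vertex_code vertex_decode.
Proof. by case. Qed.
HB.instance Definition _ := Choice.copy vertex (can_type vertex_codeK).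

Definition vdom (g : vertex) : seq nat :=
  match g with Merge k l => [:: k; l] | Split k l => [:: (k + l)%N] end.
Definition vcod (g : vertex) : seq nat :=
  match g with Merge k l => [:: (k + l)%N] | Split k l => [:: k; l] end.
Definition vertex_pos (g : vertex) : bool :=
  match g with Merge k l | Split k l => (0 < k)%N && (0 < l)%N end.

Definition web_layers : Type := seq (layer nat vertex).

Definition is_web (x : seq nat) (w : web_layers) (y : seq nat) : bool :=
  [&& is_diagram vdom vcod x w y, all (ltn 0) x
    & all (fun l : layer nat vertex => vertex_pos l.1.2) w].

(* (x, w) stands for the annular closure of w : x -> x; the annulus is such that
   the strands of w, read from left to right, are met from its core outwards. *)
Definition aweb : Type := (seq nat * web_layers)%type.
HB.instance Definition _ :=
  Choice.copy aweb (seq nat * seq (seq nat * vertex * seq nat))%type.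
Definition is_annular_web (W : aweb) : bool := is_web W.1 W.2 W.1.

(* The ladder moves below may involve a 0-labelled edge, which is erased. *)
Definition label0 (k : nat) : seq nat := if k == 0%N then [::] else [:: k].
Definition merge0 s k l t : web_layers :=
  if (k == 0%N) || (l == 0%N) then [::] else [:: (s, Merge k l, t)].
Definition split0 s k l t : web_layers :=
  if (k == 0%N) || (l == 0%N) then [::] else [:: (s, Split k l, t)].

(* On the strands k, l: moves a 1-labelled edge from the left strand to the right
   one (k > 0), resp. from the right strand to the left one (l > 0). *)
Definition move_right s k l t : web_layers :=
  split0 s k.-1 1 (label0 l ++ t) ++ merge0 (s ++ label0 k.-1) 1 l t.
Definition move_left s k l t : web_layers :=
  split0 (s ++ label0 k) 1 l.-1 t ++ merge0 s k 1 (label0 l.-1 ++ t).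

(* The formal sum of the listed terms is declared to vanish. The constraint that
   all labels are positive is imposed in [AnnularLocal]. The mirror images and
   orientation reversals of these relations are again of one of these forms. *)
Variant web_relation : seq (Qq * web_layers) -> Prop :=
  | WebExchange A B of height_exchange vdom vcod A B :
      web_relation [:: (1, A); (-1, B)]
  | WebMergeA s k l p t : web_relation
      [:: (1, [:: (s, Merge k l, p :: t); (s, Merge (k + l) p, t)]);
          (-1, [:: (s ++ [:: k], Merge l p, t); (s, Merge k (l + p), t)])]
  | WebSplitA s k l p t : web_relation
      [:: (1, [:: (s, Split (k + l) p, t); (s, Split k l, p :: t)]);
          (-1, [:: (s, Split k (l + p), t); (s ++ [:: k], Split l p, t)])]
  | WebDigon s k l t : web_relation
      [:: (1, [:: (s, Split k l, t); (s, Merge k l, t)]);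
          (- qbinom (k + l) l, [::])]
  | WebSquare s k l t of (0 < k)%N & (0 < l)%N : web_relation
      [:: (1, move_right s k l t ++ move_left s k.-1 l.+1 t);
          (-1, move_left s k l t ++ move_right s k.+1 l.-1 t);
          (- qint (k%:Z - l%:Z), [::])].

Variant annular_relation : {malg Qq[aweb]} -> Prop :=
  | AnnularLocal x u v r of web_relation r
      & all (fun cw => is_annular_web (x, u ++ cw.2 ++ v)) r :
      annular_relation (\sum_(cw <- r) << cw.1 *g (x, u ++ cw.2 ++ v) : aweb >>)
  | AnnularRotate x y u v of is_web x u y & is_web y v x :
      annular_relation (<< (x, u ++ v) : aweb >> - << (y, v ++ u) : aweb >>).

(* [annular_null x] means x = 0 in the skein module of the annulus: x lies in the
   Z[q, q^-1]-span of the relations. *)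
Inductive annular_null : {malg Qq[aweb]} -> Prop :=
  | AnnularZero : annular_null 0
  | AnnularStep c x y of laurent c & annular_relation x & annular_null y :
      annular_null (c *: x + y).

(* The bracket of a braid as the list of its terms, one for each choice of
   resolution of all the crossings. *)
Definition E_web (N i : nat) : web_layers :=
  [:: (nseq i 1%N, Merge 1 1, nseq (N - i.+2) 1%N);
      (nseq i 1%N, Split 1 1, nseq (N - i.+2) 1%N)].

Fixpoint bracket N (beta : braid N) : seq (Qq * web_layers) :=
  if beta is (i, b) :: beta' then
    [seq ((if b then - q else - q^-1) * cw.1, cw.2) | cw <- bracket beta'] ++
    [seq (cw.1, E_web N i ++ cw.2) | cw <- bracket beta']
  else [:: (1, [::])].

Definition annular_bracket N (beta : braid N) : {malg Qq[aweb]} :=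
  \sum_(cw <- bracket beta) << cw.1 *g (nseq N 1%N, cw.2) : aweb >>.

(* A collection of concentric essential circles is given by the list of its
   labels, from the core outwards. *)
Definition circle_sum : Type := {malg Qq[seq nat]}.

Definition circle_webs (C : circle_sum) : {malg Qq[aweb]} :=
  \sum_(s <- msupp C) << C@_s *g (s, [::]) : aweb >>.

(* C is the expression of the annular closure of the bracket of beta in terms of
   circles, with radially non-decreasing labels. *)
Definition is_circle_expression N (beta : braid N) (C : circle_sum) : Prop :=
  [/\ forall s, laurent C@_s,
      forall s, s \in msupp C -> all (ltn 0) s && sorted leq s &
      annular_null (annular_bracket beta - circle_webs C)].

Definition qswap (C : circle_sum) : circle_sum :=
  \sum_(s <- msupp C) << qbar C@_s *g s >>.

(* Assigns the value [val k] to each k-labelled circle. *)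
Definition assign (K : fieldType) (f : Qq -> K) (val : nat -> K)
    (C : circle_sum) : K :=
  \sum_(s <- msupp C) f C@_s * \prod_(k <- s) val k.

Definition c_wedge (k : nat) : Qqa :=
  toQqa q ^+ (k ^ 2) * a ^- k *
  \prod_(1 <= i < k.+1)
    ((1 - a ^+ 2 * toQqa q ^ (2 - (2 * i)%:Z)) / (1 - toQqa q ^+ (2 * i))).

(* Main.v *)
Require Import Defs.
From HB Require Import structures.
From mathcomp Require Import all_boot all_order all_algebra.
From mathcomp Require Import generic_quotient ring_quotient.
From mathcomp Require Import ring zify.
From mathcomp Require Import boolp.
From mathcomp Require Import finmap.
From mathcomp.multinomials Require Import monalg.

Set Implicit Arguments.
Unset Strict Implicit.
Unset Printing Implicit Defensive.

Import Order.TTheory GRing.Theory Num.Theory.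
Local Open Scope ring_scope.
Local Open Scope quotient_scope.

(** The invariant [P] itself provides the evaluation of webs. Let alpha be q^n,
    resp. a. Dividing a crossing by -alpha turns the skein relation into
    T - T^-1 = q - q^-1, so that the values of [P] on the closures of braid
    words, divided by the power of delta = P(unknot) given by the number of
    strands, form a function on words which satisfies this relation and the
    braid relations. It is cyclic, because a crossing can be slid around the
    closure ([closure_conjugate]), and it has the Markov property, because a
    kink on the innermost strand can be removed ([closure_stabilize]). In the
    free algebra on the letters modulo the radical of this function
    ([word_trace_algebra]) the Hecke relations hold, and the function becomes a
    trace tau.

    In this algebra a k-labelled edge is represented by the q-symmetrizer
    [sym o k] of k consecutive strands: merges and splits of edges labelled k
    and l both become the q-symmetrizer of k + l strands, with a quantum
    binomial coefficient on merges. Associativity and digon removal hold because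
    a larger q-symmetrizer absorbs a smaller one. A q-symmetrizer on one more
    strand can be computed by adding the strand at either end ([symS],
    [symSl]); in the square relation this expresses both products by the same
    generator, and their difference is [k - l] ([web_square]). Rotation of the
    annulus is the cyclicity of tau. Therefore the functional [web_trace],
    extended semilinearly along q <-> q^-1, vanishes on all the annular
    relations ([annular_null_trace]).

    The bracket of a crossing is sent to the corresponding generator, hence the
    bracket of a braid to tau of the braid, which is P(closure) up to the factor
    (-1)^w alpha^w and a power of delta ([braid_closure_trace]). A collection of
    circles is sent to the trace of a product of q-symmetrizers on disjoint
    strands, which the Markov property evaluates one strand at a time
    ([tau_syms]). Comparing the two values of a circle expression gives
    [braid_closure_circles]; both statements are instances of it.

    The closing strands run to the left of the braid, so the innermost strand is
    the leftmost upward one, and only there is stabilization a local move.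
    Letters and offsets are therefore counted from the right: adding a strand at
    the core then does not renumber them. *)

(** * The substitution exchanging q and its inverse *)

(** [qbar] is computed on one representing fraction; writing the arguments as
    fractions reduces its algebraic properties to those of [evalV]. *)
Lemma Qq_fracP (c : Qq) :
  exists2 pr : {poly int} * {poly int}, pr.2 != 0 & c = tofrac pr.1 / tofrac pr.2.
Proof.
exists (\n_(repr c), \d_(repr c)); first exact: denom_ratioP.
have d0 : \d_(repr c) != 0 by exact: denom_ratioP.
apply: (mulIf (x := tofrac \d_(repr c))); first by rewrite tofrac_eq0.
rewrite divfK ?tofrac_eq0 //= -[c in LHS]reprK; unlock FracField.tofrac.
rewrite -[LHS]FracField.pi_mul; apply/eqmodP.
rewrite /= FracField.equivfE /FracField.mulf !numden_Ratio ?mulr1 ?oner_neq0 //.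
by rewrite reprK mulrC.
Qed.

Lemma evalV_is_monoid_morphism : monoid_morphism evalV.
Proof. by split=> [|x y]; rewrite /evalV ?rmorph1 ?hornerC // rmorphM hornerM. Qed.
Lemma evalV_is_zmod_morphism : zmod_morphism evalV.
Proof. by move=> x y; rewrite /evalV rmorphB hornerD hornerN. Qed.
HB.instance Definition _ :=
  GRing.isZmodMorphism.Build {poly int} Qq evalV evalV_is_zmod_morphism.
HB.instance Definition _ :=
  GRing.isMonoidMorphism.Build {poly int} Qq evalV evalV_is_monoid_morphism.

Lemma qbar_tofrac p : qbar (tofrac p) = evalV p.
Proof.
by have := qbar_frac p (oner_neq0 {poly int}); rewrite !rmorph1 !divr1.
Qed.

Lemma qbar_is_monoid_morphism : monoid_morphism qbar.
Proof.
split=> [|x y]; first by rewrite -[X in qbar X](rmorph1 (@tofrac _)) qbar_tofrac rmorph1.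
have [[p r] /= r0 ->] := Qq_fracP x; have [[p' r'] /= r0' ->] := Qq_fracP y.
rewrite mulf_div -!rmorphM !qbar_frac ?mulf_neq0 //.
by rewrite !rmorphM mulf_div.
Qed.

Lemma qbar_is_zmod_morphism : zmod_morphism qbar.
Proof.
move=> x y.
have [[p r] /= r0 ->] := Qq_fracP x; have [[p' r'] /= r0' ->] := Qq_fracP y.
rewrite -mulNr addf_div ?tofrac_eq0 // -rmorphN -!rmorphM -rmorphD.
rewrite !qbar_frac ?mulf_neq0 // -mulNr addf_div ?evalV_eq0 //.
by rewrite rmorphD !rmorphM rmorphN.
Qed.
HB.instance Definition _ := GRing.isZmodMorphism.Build Qq Qq qbar qbar_is_zmod_morphism.
HB.instance Definition _ := GRing.isMonoidMorphism.Build Qq Qq qbar qbar_is_monoid_morphism.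

Lemma qbar_q : qbar q = q^-1.
Proof. by rewrite /q qbar_tofrac /evalV map_polyX hornerX. Qed.

Lemma toQqa_is_monoid_morphism : monoid_morphism toQqa.
Proof.
by split=> [|x y]; [exact: tofrac1 | rewrite /toQqa polyCM tofracM].
Qed.
Lemma toQqa_is_zmod_morphism : zmod_morphism toQqa.
Proof. by move=> x y; rewrite /toQqa polyCB tofracB. Qed.
HB.instance Definition _ := GRing.isZmodMorphism.Build Qq Qqa toQqa toQqa_is_zmod_morphism.
HB.instance Definition _ := GRing.isMonoidMorphism.Build Qq Qqa toQqa toQqa_is_monoid_morphism.

Lemma mmap_scale (X : choiceType) (R S : nzRingType) (f : {rmorphism R -> S})
    (h : X -> S) c (z : {malg R[X]}) :
  mmap f h (c *: z) = f c * mmap f h z.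
Proof.
rewrite (mmapEw (msuppZ_le _ _)) mmapE mulr_sumr.
by apply: eq_bigr => k _; rewrite mcoeffZ /= rmorphM mulrA.
Qed.

(** * Algebras attached to cyclic functions on words *)

Section TraceQuotient.
Variables (K : fieldType) (F : algType K) (phi : {scalar F}).

(** The largest two-sided ideal on which [phi] vanishes. *)
Definition radical : {pred F} := fun x => `[< forall y z, phi (y * x * z) = 0 >].

Lemma radicalP x : reflect (forall y z, phi (y * x * z) = 0) (x \in radical).
Proof. exact: asboolP. Qed.

Lemma radical_zmod_closed : zmod_closed radical.
Proof.
split=> [|x y /radicalP x0 /radicalP y0]; apply/radicalP => a b.
  by rewrite mulr0 mul0r linear0.
by rewrite mulrBr mulrBl linearB /= x0 y0 subrr.
Qed.

HB.instance Definition _ := GRing.isZmodClosed.Build F radical radical_zmod_closed.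

Lemma radicalMl a x : x \in radical -> a * x \in radical.
Proof. by move/radicalP=> x0; apply/radicalP => y z; rewrite mulrA x0. Qed.
Lemma radicalMr a x : x \in radical -> x * a \in radical.
Proof. by move/radicalP=> x0; apply/radicalP => y z; rewrite mulrA -mulrA x0. Qed.

Hypothesis phi1 : phi 1 != 0.

(** The proof that [phi 1] is nonzero is part of the type because it makes the
    quotient ring nontrivial. *)
Definition trace_quotient of phi 1 != 0 := Quotient.quot radical.
Local Notation Q := (trace_quotient phi1).

HB.instance Definition _ := GRing.Zmodule.on Q.
HB.instance Definition _ := EqQuotient.on Q.

Definition proj (x : F) : Q := \pi_(Quotient.quot radical) x.

Lemma proj_repr (x : Q) : proj (repr x) = x. Proof. exact: reprK. Qed.

Lemma proj_eq x y : (proj x = proj y) <-> (x - y \in radical).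
Proof. by rewrite Quotient.idealrBE; split=> [e|/eqP //]; apply/eqP. Qed.

Lemma proj_is_zmod_morphism : zmod_morphism proj.
Proof. by move=> x y; rewrite /proj !piE. Qed.
HB.instance Definition _ := GRing.isZmodMorphism.Build F Q proj proj_is_zmod_morphism.

Lemma repr_proj x : x - repr (proj x) \in radical.
Proof. by apply/proj_eq; rewrite proj_repr. Qed.

Definition qmul (x y : Q) : Q := proj (repr x * repr y).
Definition qscale (c : K) (x : Q) : Q := proj (c *: repr x).

Lemma projM x y : proj (x * y) = qmul (proj x) (proj y).
Proof.
apply/proj_eq; rewrite -[x * y](subrK (x * repr (proj y))) -mulrBr.
rewrite -addrA -mulrBl rpredD //; first exact/radicalMl/repr_proj.
exact/radicalMr/repr_proj.
Qed.

Lemma projZ c x : proj (c *: x) = qscale c (proj x).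
Proof.
apply/proj_eq; rewrite -scalerBr -mulr_algl; exact/radicalMl/repr_proj.
Qed.

Lemma qmulA : associative qmul.
Proof.
by move=> x y z; rewrite -(proj_repr x) -(proj_repr y) -(proj_repr z) -!projM mulrA.
Qed.
Lemma qmul1 : left_id (proj 1) qmul.
Proof. by move=> x; rewrite -(proj_repr x) -projM mul1r. Qed.
Lemma qmulr1 : right_id (proj 1) qmul.
Proof. by move=> x; rewrite -(proj_repr x) -projM mulr1. Qed.
Lemma qmulDl : left_distributive qmul +%R.
Proof.
move=> x y z; rewrite -(proj_repr x) -(proj_repr y) -(proj_repr z).
by rewrite -raddfD -!projM mulrDl raddfD.
Qed.
Lemma qmulDr : right_distributive qmul +%R.
Proof.
move=> x y z; rewrite -(proj_repr x) -(proj_repr y) -(proj_repr z).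
by rewrite -raddfD -!projM mulrDr raddfD.
Qed.
Lemma q1_neq0 : proj 1 != 0.
Proof.
apply/eqP; rewrite -(raddf0 proj) => /proj_eq; rewrite subr0 => /radicalP/(_ 1 1).
by rewrite !mulr1 => /eqP; apply/negP.
Qed.
HB.instance Definition _ :=
  GRing.Zmodule_isNzRing.Build Q qmulA qmul1 qmulr1 qmulDl qmulDr q1_neq0.

Lemma qscaleA a b x : qscale a (qscale b x) = qscale (a * b) x.
Proof. by rewrite -(proj_repr x) -!projZ scalerA. Qed.
Lemma qscale1 : left_id 1 qscale.
Proof. by move=> x; rewrite -(proj_repr x) -projZ scale1r. Qed.
Lemma qscaleDr : right_distributive qscale +%R.
Proof.
move=> a x y; rewrite -(proj_repr x) -(proj_repr y).
by rewrite -raddfD -!projZ scalerDr raddfD.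
Qed.
Lemma qscaleDl x : {morph qscale^~ x : a b / a + b}.
Proof. by move=> a b; rewrite -(proj_repr x) -!projZ scalerDl raddfD. Qed.
HB.instance Definition _ :=
  GRing.Zmodule_isLmodule.Build K Q qscaleA qscale1 qscaleDr qscaleDl.

Lemma qscalerAl a (x y : Q) : a *: (x * y) = (a *: x) * y.
Proof.
have pM u w : proj u * proj w = proj (u * w) by rewrite projM.
have pZ u : a *: proj u = proj (a *: u) by rewrite projZ.
by rewrite -(proj_repr x) -(proj_repr y) !(pM, pZ) scalerAl.
Qed.
HB.instance Definition _ := GRing.Lmodule_isLalgebra.Build K Q qscalerAl.
Lemma qscalerAr a (x y : Q) : a *: (x * y) = x * (a *: y).
Proof.
have pM u w : proj u * proj w = proj (u * w) by rewrite projM.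
have pZ u : a *: proj u = proj (a *: u) by rewrite projZ.
by rewrite -(proj_repr x) -(proj_repr y) !(pM, pZ) scalerAr.
Qed.
HB.instance Definition _ := GRing.Lalgebra_isAlgebra.Build K Q qscalerAr.

Lemma proj_is_monoid_morphism : monoid_morphism proj.
Proof. by split=> // x y; exact: projM. Qed.
HB.instance Definition _ := GRing.isMonoidMorphism.Build F Q proj proj_is_monoid_morphism.
Lemma proj_is_scalable : scalable proj.
Proof. exact: projZ. Qed.
HB.instance Definition _ := GRing.isScalable.Build K F Q *:%R proj proj_is_scalable.

Definition quotient_trace (x : Q) : K := phi (repr x).

Lemma quotient_trace_proj x : quotient_trace (proj x) = phi x.
Proof.
apply/esym/eqP; rewrite -subr_eq0 -linearB /=.
by have /radicalP/(_ 1 1) := repr_proj x; rewrite mulr1 mul1r => ->.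
Qed.

Lemma quotient_trace_is_scalar : scalar quotient_trace.
Proof.
move=> a x y; rewrite -(proj_repr x) -(proj_repr y) -linearP !quotient_trace_proj.
exact: linearP.
Qed.
HB.instance Definition _ := GRing.isLinear.Build K Q K *%R quotient_trace quotient_trace_is_scalar.

End TraceQuotient.

(** Identities for [phi] only have to be checked on a family spanning the
    algebra; the span is given by its induction principle. *)
Section Spanned.
Variables (K : fieldType) (F : algType K) (phi : {scalar F}) (I : Type) (b : I -> F).
Hypothesis spanned : forall Q : F -> Prop, (forall i, Q (b i)) -> Q 0 ->
  (forall c x, Q x -> Q (c *: x)) -> (forall x y, Q x -> Q y -> Q (x + y)) ->
  forall x, Q x.

Lemma spanned_traceC : (forall i j, phi (b i * b j) = phi (b j * b i)) ->
  forall x y, phi (x * y) = phi (y * x).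
Proof.
move=> phiC x y.
elim/spanned: x => [u||c x IH|x z IHx IHz].
- elim/spanned: y => [w||c y IH|y z IHy IHz].
  + exact: phiC.
  + by rewrite mulr0 mul0r.
  + by rewrite -scalerAl -scalerAr !scalarZ IH.
  + by rewrite mulrDl mulrDr !linearD /= IHy IHz.
- by rewrite mulr0 mul0r.
- by rewrite -scalerAl -scalerAr !scalarZ IH.
- by rewrite mulrDl mulrDr !linearD /= IHx IHz.
Qed.

Lemma spanned_radical x : (forall i j, phi (b i * x * b j) = 0) -> x \in radical phi.
Proof.
move=> x0; apply/radicalP => y z.
elim/spanned: y => [u||c y IH|y y' IHy IHz].
- elim/spanned: z => [w||c z IH|y z IHy IHz].
  + exact: x0.
  + by rewrite mulr0 linear0.
  + by rewrite -scalerAr scalarZ IH mulr0.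
  + by rewrite mulrDr linearD /= IHy IHz addr0.
- by rewrite !mul0r linear0.
- by rewrite -!scalerAl scalarZ IH mulr0.
- by rewrite !mulrDl linearD /= IHy IHz addr0.
Qed.

Hypothesis phi1 : phi 1 != 0.
Local Notation pr := (proj phi1).
Local Notation tau := (@quotient_trace _ _ _ phi1).

Lemma quotient_eq x y :
  (forall i j, tau (pr (b i) * x * pr (b j)) = tau (pr (b i) * y * pr (b j))) -> x = y.
Proof.
rewrite -(proj_repr x) -(proj_repr y) => xy; apply/proj_eq/spanned_radical => i j.
apply/eqP; rewrite mulrBr mulrBl linearB subr_eq0; apply/eqP.
have pM u w : pr u * pr w = pr (u * w) by rewrite rmorphM.
by have := xy i j; rewrite !pM !quotient_trace_proj.
Qed.

Lemma quotient_traceC x y :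
  (forall i j, phi (b i * b j) = phi (b j * b i)) -> tau (x * y) = tau (y * x).
Proof.
move=> phiC; rewrite -(proj_repr x) -(proj_repr y).
have pM u w : pr u * pr w = pr (u * w) by rewrite rmorphM.
by rewrite !pM !quotient_trace_proj; apply: spanned_traceC.
Qed.

End Spanned.

(** A name of its own for this monoid algebra is needed to give it an algebra
    structure: on the bare monoid algebra the canonical one expects a
    commutative monoid. *)
Definition free_algebra (R : comNzRingType) (X : choiceType) := {malg R[{fmonom X}]}.

Section FreeAlgebra.
Variables (R : comNzRingType) (X : choiceType).
Local Notation F := (free_algebra R X).
HB.instance Definition _ := GRing.Lalgebra.on F.

Lemma free_scalerAr (c : R) (x y : F) : c *: (x * y) = x * (c *: y).
Proof.
have cx : x * (c%:MP : F) = (c%:MP : F) * x.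
  rewrite !malgM_def fgmulgU fgmulUg; apply: eq_bigr => k _.
  by rewrite mulm1 mul1m mulrC.
by rewrite -[c *: (x * y)]mul_malgC -[c *: y]mul_malgC mulrA -cx mulrA.
Qed.
HB.instance Definition _ := GRing.Lalgebra_isAlgebra.Build R F free_scalerAr.

Definition word (w : seq X) : F := << FMonom w >>.

Lemma word_cat u w : word (u ++ w) = word u * word w.
Proof.
rewrite /word [RHS]malgM_def fgmulUU mulr1; congr << _ >>.
by apply: val_inj; rewrite /= fmM.
Qed.

Lemma word_nil : word [::] = 1.
Proof. by congr << _ >>; apply: val_inj; rewrite /= fm1. Qed.

Lemma free_ind (Q : F -> Prop) : (forall w, Q (word w)) -> Q 0 ->
  (forall c x, Q x -> Q (c *: x)) -> (forall x y, Q x -> Q y -> Q (x + y)) ->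
  forall x, Q x.
Proof.
move=> Qw Q0 QZ QD x; rewrite [x]monalgE.
elim/big_ind: _ => // -[k] _.
have -> : << x@_(FMonom k) *g FMonom k >> = x@_(FMonom k) *: word k.
  by apply/malgP => m; rewrite mcoeffZ !mcoeffU; case: eqP; rewrite ?mulr1 ?mulr0.
exact/QZ/Qw.
Qed.

Variable tr : seq X -> R.
Definition word_form (x : F) : R := mmap idfun (fun m : {fmonom X} => tr m) x.

Lemma word_form_word w : word_form (word w) = tr w.
Proof. by rewrite /word_form mmapU mul1r. Qed.

Lemma word_form_is_scalar : scalar word_form.
Proof. by move=> c x y; rewrite /word_form raddfD /= mmap_scale. Qed.
HB.instance Definition _ := GRing.isLinear.Build R F R *%R word_form word_form_is_scalar.

End FreeAlgebra.

(** The last condition says that the trace form is nondegenerate: an equality in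
    [H] can be tested inside words, that is, on closed diagrams. *)
Lemma word_trace_algebra (K : fieldType) (X : choiceType) (tr : seq X -> K) :
    tr [::] != 0 -> (forall u w, tr (u ++ w) = tr (w ++ u)) ->
  exists (H : algType K) (tau : {scalar H}) (h : seq X -> H),
    [/\ h [::] = 1, forall u w, h (u ++ w) = h u * h w,
        forall w, tau (h w) = tr w, forall x y : H, tau (x * y) = tau (y * x) &
        forall x y : H, (forall u w, tau (h u * x * h w) = tau (h u * y * h w)) -> x = y].
Proof.
move=> tr0 trC.
have phi1 : word_form tr 1 != 0 by rewrite -word_nil word_form_word.
exists (trace_quotient phi1), (@quotient_trace _ _ _ phi1).
exists (fun w => proj phi1 (word K w)); split.
- by rewrite word_nil rmorph1.
- by move=> u w; rewrite word_cat rmorphM.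
- by move=> w; apply: etrans (quotient_trace_proj _ _) (word_form_word _ _).
- move=> x y; apply: (quotient_traceC (@free_ind K X)) => u w.
  rewrite -!word_cat; apply: etrans (word_form_word _ _) _.
  by rewrite trC; apply/esym/word_form_word.
- exact: (quotient_eq (@free_ind K X)).
Qed.

(** * Quantum integers *)

HB.lock Definition qnum (K : fieldType) (v : K) (k : int) : K :=
  (v ^ k - v ^ (- k)) / (v - v^-1).

Section Hecke.
Variables (K : fieldType) (v : K).
Hypothesis v_neq0 : v != 0.
Hypothesis qnum_neq0 : forall k : nat, qnum v k.+1 != 0.

Lemma subvV_neq0 : v - v^-1 != 0.
Proof.
apply/eqP=> e; have := qnum_neq0 0.
by rewrite qnum.unlock e invr0 mulr0 eqxx.
Qed.

Lemma qnumE (k : int) : qnum v k * (v - v^-1) = v ^ k - v ^ (- k).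
Proof. by rewrite qnum.unlock divfK // subvV_neq0. Qed.

Lemma qnum0 : qnum v 0 = 0.
Proof. by rewrite qnum.unlock oppr0 subrr mul0r. Qed.

Lemma qnum1 : qnum v 1 = 1.
Proof. by apply: (mulIf subvV_neq0); rewrite qnumE mul1r. Qed.

Lemma qnumS (k : nat) : v ^- k + qnum v k * v = qnum v k.+1.
Proof.
apply: (mulIf subvV_neq0); rewrite qnumE mulrDl mulrAC qnumE.
rewrite -!exprnN -!exprnP exprS.
by field; rewrite v_neq0 expf_neq0.
Qed.

(** The scalar identity behind the square relation. *)
Lemma qnumB (k l : nat) :
  qnum v k * v ^- l - qnum v l * v ^- k = qnum v (k%:Z - l%:Z).
Proof.
apply: (mulIf subvV_neq0); rewrite mulrBl ![_ * v ^- _ * _]mulrAC !qnumE.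
rewrite opprB !expfzDr // -!exprnN -!exprnP.
by field; rewrite !expf_neq0.
Qed.

(** * q-symmetrizers in Hecke algebras *)

Variables (A : algType K) (T : nat -> A).
Hypothesis T_quad : forall i, T i * T i = 1 + (v - v^-1) *: T i.
Hypothesis T_braid : forall i, T i * T i.+1 * T i = T i.+1 * T i * T i.+1.
Hypothesis T_comm : forall i j, (i.+1 < j)%N -> GRing.comm (T i) (T j).

(** The q-symmetrizer on the strands o, ..., o + k - 1, normalized to be
    idempotent: the generators [T i] between these strands act on it by v. It is
    defined by adding the last strand, and then locked, as it would otherwise be
    unfolded by the unification of scaled products. *)
Fixpoint sym_rec (o k : nat) : A :=
  if k is k'.+1 then
    (qnum v k)^-1 *: (v ^- k' *: sym_rec o k'
                      + qnum v k' *: (sym_rec o k' * T (o + k').-1 * sym_rec o k'))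
  else 1.

Fact sym_key : unit. Proof. exact: tt. Qed.
Definition sym := locked_with sym_key sym_rec.
Canonical sym_unlockable := [unlockable of sym].

Lemma sym0 o : sym o 0 = 1. Proof. by rewrite [sym]unlock. Qed.

Lemma symS o k : qnum v k.+1 *: sym o k.+1 =
  v ^- k *: sym o k + qnum v k *: (sym o k * T (o + k).-1 * sym o k).
Proof. by rewrite [sym]unlock /= scalerA divff ?scale1r. Qed.

Lemma sym1 o : sym o 1 = 1.
Proof. by rewrite [sym]unlock /= qnum0 scale0r addr0 qnum1 !invr1 !scale1r. Qed.

Lemma commZ (x y : A) c : GRing.comm x y -> GRing.comm x (c *: y).
Proof. by rewrite /GRing.comm -scalerAl -scalerAr => ->. Qed.

Lemma sym_comm o k x :
    (forall i, (o <= i)%N -> (i.+1 < o + k)%N -> GRing.comm x (T i)) ->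
  GRing.comm x (sym o k).
Proof.
elim: k => [|[|k] IHk] xT; first by rewrite sym0; exact: commr1.
  by rewrite sym1; exact: commr1.
have xs : GRing.comm x (sym o k.+1) by apply: IHk => i oi ik; apply: xT => //; lia.
rewrite -[sym _ _]scale1r -(mulVf (qnum_neq0 k.+1)) -scalerA symS.
apply: commZ; apply: commrD; apply: commZ => //.
by do 2![apply: commrM => //]; apply: xT; lia.
Qed.

(** [sym o k] is a combination of products of generators whose coefficients add
    up to 1 when each generator is replaced by v; this is [qnumS]. *)
Lemma sym_fixl o k z :
    (forall i, (o <= i)%N -> (i.+1 < o + k)%N -> T i * z = v *: z) ->
  sym o k * z = z.
Proof.
elim: k => [|[|k] IHk] zT; first by rewrite sym0 mul1r.
  by rewrite sym1 mul1r.
have zs : sym o k.+1 * z = z by apply: IHk => i oi ik; apply: zT => //; lia.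
apply: (scalerI (qnum_neq0 k.+1)); rewrite scalerAl symS mulrDl -!scalerAl zs.
rewrite -!mulrA zs zT; [|lia..].
by rewrite -scalerAr zs scalerA -scalerDl qnumS.
Qed.

Lemma sym_fixr o k z :
    (forall i, (o <= i)%N -> (i.+1 < o + k)%N -> z * T i = v *: z) ->
  z * sym o k = z.
Proof.
elim: k => [|[|k] IHk] zT; first by rewrite sym0 mulr1.
  by rewrite sym1 mulr1.
have zs : z * sym o k.+1 = z by apply: IHk => i oi ik; apply: zT => //; lia.
apply: (scalerI (qnum_neq0 k.+1)); rewrite scalerAr symS mulrDr -!scalerAr zs.
rewrite !mulrA zs zT; [|lia..].
by rewrite -scalerAl zs scalerA -scalerDl qnumS.
Qed.

(** v is a root of the quadratic relation, with cofactor [v^-1 + T i]. *)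
Lemma T_eigenl i : T i * (v^-1 *: 1 + T i) = v *: (v^-1 *: 1 + T i).
Proof.
rewrite mulrDr -scalerAr mulr1 T_quad scalerDr scalerA divff // scale1r.
by rewrite addrCA -scalerDl subrKC.
Qed.

Lemma T_eigenr i : (v^-1 *: 1 + T i) * T i = v *: (v^-1 *: 1 + T i).
Proof.
rewrite mulrDl -scalerAl mul1r T_quad scalerDr scalerA divff // scale1r.
by rewrite addrCA -scalerDl subrKC.
Qed.

Lemma braid_eigenl i j z :
  T j * T i * T j = T i * T j * T i -> T i * z = v *: z ->
  T j * (T i * (T j * z)) = v *: (T i * (T j * z)).
Proof. by move=> b e; rewrite !mulrA b -!mulrA e -!scalerAr !mulrA. Qed.

Lemma braid_eigenr i j z :
  T j * T i * T j = T i * T j * T i -> z * T i = v *: z ->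
  z * T j * T i * T j = v *: (z * T j * T i).
Proof. by move=> b e; rewrite -!mulrA [T j * _]mulrA b !mulrA e -!scalerAl. Qed.

(** Absorption of the new generator [T j] by the next q-symmetrizer. After
    expanding the left factor e, one part of y contains the cofactor
    [v^-1 + T j], and in the other part the braid relation carries [T j] across
    to [T i], which e absorbs. *)
Lemma sym_step_eigenl i j k (e' e : A) :
    T j * T i * T j = T i * T j * T i -> GRing.comm e' (T j) ->
    qnum v k.+1 *: e = v ^- k *: e' + qnum v k *: (e' * T i * e') ->
    e' * e = e -> T i * e = v *: e ->
  let y := v ^- k.+1 *: e + qnum v k.+1 *: (e * T j * e) in T j * y = v *: y.
Proof.
move=> b c eE ee te y.
have -> : y = v ^- k *: ((v^-1 *: 1 + T j) * e) + qnum v k *: (e' * (T i * (T j * e))).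
  rewrite /y -mulrA scalerAl eE !mulrDl -!scalerAl !mulrA -[_ * e' * T j]mulrA c.
  by rewrite -!mulrA ee mul1r scalerDr scalerA -invfM -exprSr addrA.
rewrite mulrDr -!scalerAr scalerDr !mulrA T_eigenl -c -!mulrA braid_eigenl //.
by rewrite -!scalerAr -!scalerAl !scalerA ![v * _]mulrC.
Qed.

Lemma sym_step_eigenr i j k (e' e : A) :
    T j * T i * T j = T i * T j * T i -> GRing.comm e' (T j) ->
    qnum v k.+1 *: e = v ^- k *: e' + qnum v k *: (e' * T i * e') ->
    e * e' = e -> e * T i = v *: e ->
  let y := v ^- k.+1 *: e + qnum v k.+1 *: (e * T j * e) in y * T j = v *: y.
Proof.
move=> b c eE ee te y.
have -> : y = v ^- k *: (e * (v^-1 *: 1 + T j)) + qnum v k *: (e * T j * T i * e').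
  rewrite /y scalerAr eE !mulrDr -!scalerAr !mulrA -[_ * T j * e']mulrA -c.
  by rewrite !mulrA ee mulr1 scalerDr scalerA -invfM -exprSr addrA.
rewrite mulrDl -!scalerAl scalerDr -!mulrA T_eigenr c !mulrA braid_eigenr //.
by rewrite -!scalerAr -!scalerAl !scalerA ![v * _]mulrC.
Qed.

Lemma T_sym o k i : (o <= i)%N -> (i.+1 < o + k)%N -> T i * sym o k = v *: sym o k.
Proof.
elim: k i => [|k IHk] i oi; first by lia.
rewrite addnS ltnS leq_eqVlt => /orP[/eqP ik | ik]; last first.
  apply: (scalerI (qnum_neq0 k)); rewrite scalerAr scalerA [_ * v]mulrC -scalerA.
  by rewrite symS mulrDr -!scalerAr !mulrA IHk // -!scalerAl scalerDr !scalerA ![v * _]mulrC.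
apply: (scalerI (qnum_neq0 k)); rewrite scalerAr scalerA [_ * v]mulrC -scalerA symS.
have -> : (o + k).-1 = i by rewrite -ik.
case: k IHk ik => [|[|k]] IHk ik; first by lia.
  by rewrite sym1 !mulr1 mul1r expr1 qnum1 scale1r; exact: T_eigenl.
have -> : i = (o + k).+1 by lia.
apply: (@sym_step_eigenl (o + k) _ _ (sym o k.+1)); first by rewrite T_braid.
- by apply/commr_sym/sym_comm => j oj jk; apply/commr_sym/T_comm; lia.
- by rewrite symS addnS.
- by apply: sym_fixl => j oj jk; apply: IHk => //; lia.
- by apply: IHk; lia.
Qed.

Lemma sym_T o k i : (o <= i)%N -> (i.+1 < o + k)%N -> sym o k * T i = v *: sym o k.
Proof.
elim: k i => [|k IHk] i oi; first by lia.
rewrite addnS ltnS leq_eqVlt => /orP[/eqP ik | ik]; last first.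
  apply: (scalerI (qnum_neq0 k)); rewrite scalerAl scalerA [_ * v]mulrC -scalerA.
  rewrite symS mulrDl -!scalerAl -!mulrA IHk // -!scalerAr scalerDr !scalerA.
  by rewrite ![v * _]mulrC.
apply: (scalerI (qnum_neq0 k)); rewrite scalerAl scalerA [_ * v]mulrC -scalerA symS.
have -> : (o + k).-1 = i by rewrite -ik.
case: k IHk ik => [|[|k]] IHk ik; first by lia.
  by rewrite sym1 !mulr1 mul1r expr1 qnum1 scale1r; exact: T_eigenr.
have -> : i = (o + k).+1 by lia.
apply: (@sym_step_eigenr (o + k) _ _ (sym o k.+1)); first by rewrite T_braid.
- by apply/commr_sym/sym_comm => j oj jk; apply/commr_sym/T_comm; lia.
- by rewrite symS addnS.
- by apply: sym_fixr => j oj jk; apply: IHk => //; lia.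
- by apply: IHk; lia.
Qed.

(** The right-hand side absorbs the same generators as [sym o k.+1], hence is fixed
    by it; conversely [sym o k.+1] absorbs all of its terms. *)
Lemma symSl o k : qnum v k.+1 *: sym o k.+1 =
  v ^- k *: sym o.+1 k + qnum v k *: (sym o.+1 k * T o * sym o.+1 k).
Proof.
elim: k => [|k IHk] in o *; first by rewrite symS qnum0 !sym0 !scale0r.
set y := RHS.
have ->: y = sym o k.+2 * y.
  apply/esym/sym_fixl => i oi ik.
  have [oi'|oi'] := ltnP o i.
    by rewrite mulrDr -!scalerAr !mulrA T_sym -?scalerAl ?scalerDr ?scalerA ?[v * _]mulrC //; lia.
  have {oi oi' ik}-> : i = o by lia.
  rewrite /y; case: k IHk {y} => [|k] IHk.
    by rewrite sym1 !mulr1 mul1r expr1 qnum1 scale1r; exact: T_eigenl.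
  apply: (@sym_step_eigenl o.+1 _ _ (sym o.+2 k.+1)); first by rewrite T_braid.
  - by apply/commr_sym/sym_comm => j oj jk; apply/T_comm; lia.
  - exact: IHk.
  - by apply: sym_fixl => j oj jk; apply: T_sym => //; lia.
  - by apply: T_sym; lia.
have s1 : sym o k.+2 * sym o.+1 k.+1 = sym o k.+2.
  by apply: sym_fixr => j oj jk; apply: sym_T => //; lia.
rewrite mulrDr -!scalerAr !mulrA s1 sym_T; [|lia..].
by rewrite -scalerAl s1 scalerA -scalerDl qnumS.
Qed.

Lemma sym_absorbl o k o' k' : (o <= o')%N -> (o' + k' <= o + k)%N ->
  sym o' k' * sym o k = sym o k.
Proof. by move=> oo kk; apply: sym_fixl => i oi ik; apply: T_sym; lia. Qed.

Lemma sym_absorbr o k o' k' : (o <= o')%N -> (o' + k' <= o + k)%N ->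
  sym o k * sym o' k' = sym o k.
Proof. by move=> oo kk; apply: sym_fixr => i oi ik; apply: sym_T; lia. Qed.

Lemma sym_sym_comm o k o' k' : (o + k <= o')%N -> GRing.comm (sym o k) (sym o' k').
Proof.
move=> ok; apply: sym_comm => i oi ik; apply/commr_sym/sym_comm => j oj jk.
by apply/commr_sym/T_comm; lia.
Qed.

(** * Idempotents of sequences of labels *)

(** [inblock o x i]: the generator [T i] exchanges two strands of the same edge,
    when the edges labelled by [x] are expanded into strands, numbered from the
    right starting from [o]. *)
Fixpoint inblock (o : nat) (x : seq nat) (i : nat) : bool :=
  if x is k :: t then
    (o + sumn t <= i)%N && (i.+1 < o + sumn t + k)%N || inblock o t i
  else false.

Lemma inblock_cat o s t i :
  inblock o (s ++ t) i = inblock (o + sumn t) s i || inblock o t i.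
Proof.
elim: s => //= k s ->; rewrite sumn_cat orbA; congr (_ && _ || _ || _).
  by rewrite addnAC addnA.
by rewrite [(sumn s + _)%N]addnC addnA.
Qed.

Lemma inblock_range o x i : inblock o x i -> (o <= i)%N /\ (i.+1 < o + sumn x)%N.
Proof. by elim: x => //= k t IH /orP[/andP[]|/IH]; lia. Qed.

(** The identity web on the labels [x], as an element of the algebra. *)
Fixpoint syms (x : seq nat) : A :=
  if x is k :: t then sym (sumn t) k * syms t else 1.

Lemma syms_comm x z :
    (forall i, inblock 0 x i -> GRing.comm z (T i)) -> GRing.comm z (syms x).
Proof.
elim: x => [|k t IH] zT; first exact: commr1.
apply: commrM; last by apply: IH => i it; apply: zT => /=; rewrite it orbT.
by apply: sym_comm => i oi ik; apply: zT => /=; rewrite add0n oi ik.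
Qed.

Lemma syms_T x i : inblock 0 x i -> syms x * T i = v *: syms x.
Proof.
elim: x => //= k t IH /orP[/andP[ti ik]|it]; last by rewrite -mulrA IH // -scalerAr.
rewrite add0n in ti ik; rewrite -mulrA -[syms t * _](@syms_comm _ (T i)); last first.
  by move=> j /inblock_range[_ jt]; apply/commr_sym/T_comm; lia.
by rewrite mulrA sym_T // -scalerAl.
Qed.

Lemma T_syms x i : inblock 0 x i -> T i * syms x = v *: syms x.
Proof.
elim: x => //= k t IH /orP[/andP[ti ik]|it].
  by rewrite add0n in ti ik; rewrite mulrA T_sym // -scalerAl.
have [_ jt] := inblock_range it.
rewrite mulrA (_ : T i * _ = sym (sumn t) k * T i); first by rewrite -mulrA IH // -scalerAr.
by apply: sym_comm => j oj jk; apply: T_comm; lia.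
Qed.

Lemma syms_fixr x z :
    (forall i, inblock 0 x i -> z * T i = v *: z) -> z * syms x = z.
Proof.
elim: x => [|k t IH] zT /=; first exact: mulr1.
rewrite mulrA sym_fixr ?IH // => i; last by move=> oi ik; apply: zT; rewrite /= oi ik.
by move=> it; apply: zT; rewrite /= it orbT.
Qed.

Lemma syms_absorbr x o k : (forall i, (o <= i)%N -> (i.+1 < o + k)%N -> inblock 0 x i) ->
  syms x * sym o k = syms x.
Proof. by move=> h; apply: sym_fixr => i oi ik; apply/syms_T/h. Qed.

Lemma syms_ones n : syms (nseq n 1%N) = 1.
Proof. by elim: n => //= n ->; rewrite sym1 mulr1. Qed.

(** * Webs *)

Definition qfact (k : nat) : K := \prod_(i < k) qnum v i.+1%:Z.

Lemma qfact_neq0 k : qfact k != 0.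
Proof. by apply/prodf_neq0 => i _; apply: qnum_neq0. Qed.

Lemma qfact0 : qfact 0 = 1. Proof. by rewrite /qfact big_ord0. Qed.
Lemma qfactS k : qfact k.+1 = qfact k * qnum v k.+1.
Proof. by rewrite /qfact big_ord_recr. Qed.
Lemma qfact1 : qfact 1 = 1. Proof. by rewrite qfactS qfact0 mul1r qnum1. Qed.

(** Merges and splits are both proportional to a q-symmetrizer; putting the whole
    coefficient of the digon relation on merges keeps splits idempotent. *)
Definition vertex_coef (g : vertex) : K :=
  if g is Merge k l then qfact (k + l) / (qfact k * qfact l) else 1.

Definition vertex_size (g : vertex) : nat :=
  match g with Merge k l | Defs.Split k l => k + l end.

Definition layer_elt (l : layer nat vertex) : A :=
  vertex_coef l.1.2 *: sym (sumn l.2) (vertex_size l.1.2).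

Definition web_elt (w : web_layers) : A := \prod_(l <- w) layer_elt l.

Lemma web_elt_cat u w : web_elt (u ++ w) = web_elt u * web_elt w.
Proof. exact: big_cat. Qed.

Lemma web_elt_cons l w : web_elt (l :: w) = layer_elt l * web_elt w.
Proof. exact: big_cons. Qed.

Lemma web_elt_nil : web_elt [::] = 1.
Proof. exact: big_nil. Qed.

Definition web_eltE := (web_elt_cat, web_elt_cons, web_elt_nil).

Lemma layer_elt_top (l : layer nat vertex) :
  syms (bottom vdom l) * layer_elt l * syms (top vcod l)
    = syms (bottom vdom l) * layer_elt l.
Proof.
apply: syms_fixr => i; case: l => [[s g] t].
rewrite /layer_elt /top /bottom /= !inblock_cat !add0n => h.
rewrite -scalerAr -scalerAl scalerA [v * _]mulrC -scalerA.
congr (_ *: _).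
have [/andP[ti ik]|] := boolP ((sumn t <= i)%N && (i.+1 < sumn t + vertex_size g)%N).
  by rewrite -mulrA sym_T // -scalerAr.
rewrite negb_and -!leqNgt -ltnNge => out.
have sg : sumn (vcod g) = vertex_size g by case: (g) => k l /=; rewrite ?addn0.
have sd : sumn (vdom g) = vertex_size g by case: (g) => k l /=; rewrite ?addn0.
have hb : inblock 0 (s ++ vdom g ++ t) i.
  rewrite !inblock_cat !add0n sumn_cat sd; case/or3P: h => [h|h|->]; rewrite ?orbT //.
    by rewrite -sg -sumn_cat h.
  by move/inblock_range: h; rewrite sg; lia.
have far : GRing.comm (T i) (sym (sumn t) (vertex_size g)).
  move: h; rewrite sumn_cat sg; case/or3P=> /inblock_range [h1 h2];
    apply: sym_comm => j tj jk; [apply/commr_sym/T_comm|move: out h1 h2|apply/T_comm];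
    rewrite ?sg; lia.
by rewrite -mulrA -far mulrA syms_T // -scalerAl.
Qed.

(** Once multiplied by the idempotent of its source, a web absorbs the one of its
    target, so the idempotents of intermediate levels can be inserted at will. *)
Lemma web_elt_top x w y : is_diagram vdom vcod x w y ->
  syms x * web_elt w * syms y = syms x * web_elt w.
Proof.
elim: w x => [|l w IH] x /=.
  move/eqP->; rewrite web_elt_nil mulr1; apply: syms_fixr; exact: syms_T.
case/andP=> /eqP-> /IH e; rewrite web_elt_cons mulrA -layer_elt_top.
by rewrite -!mulrA; do 2![congr (_ * _)]; rewrite mulrA.
Qed.

(** * Relations between webs *)

(** Relations of webs are read through q <-> q^-1: the symmetrizers satisfy
    them with parameter v, and the coefficients are transported by a morphism
    with [g q = v^-1]. *)
Variable g : {rmorphism Qq -> K}.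
Hypothesis g_q : g q = v^-1.

Lemma g_qint k : g (qint k) = qnum v k.
Proof.
apply: (mulIf subvV_neq0); rewrite qnumE /qint fmorph_div !rmorphB fmorphV.
rewrite !fmorphXz g_q invrK !exprz_inv opprK -[v^-1 - v]opprB invrN mulrN mulNr.
by rewrite divfK ?opprB // subvV_neq0.
Qed.

Lemma g_qbinom k l : g (qbinom (k + l) l) = qfact (k + l) / (qfact k * qfact l).
Proof.
rewrite /qbinom rmorph_prod.
rewrite (eq_bigr (fun i : 'I_l => qnum v ((k + l)%N%:Z - i%:Z) / qnum v i.+1)); last first.
  by move=> i _; rewrite fmorph_div !g_qint.
rewrite prodf_div; have := qfact_neq0 k; have := qfact_neq0 l => l0 k0.
suff -> : qfact (k + l) = qfact k * \prod_(i < l) qnum v ((k + l)%N%:Z - i%:Z).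
  by rewrite -/(qfact l); field; rewrite k0 l0.
rewrite {1}/qfact big_split_ord /=; congr (_ * _).
rewrite [RHS](reindex_inj rev_ord_inj) /=; apply: eq_bigr => i _.
by congr (qnum v _); have := ltn_ord i; lia.
Qed.

Lemma vertex_coefA k l p :
  vertex_coef (Merge k l) * vertex_coef (Merge (k + l) p) =
  vertex_coef (Merge l p) * vertex_coef (Merge k (l + p)).
Proof. by rewrite /= addnA; field; rewrite !qfact_neq0. Qed.

Lemma vertex_coefk1 k : vertex_coef (Merge k 1) = qnum v k.+1.
Proof. by rewrite /= addn1 qfactS qfact1; field; rewrite qfact_neq0. Qed.
Lemma vertex_coef1k k : vertex_coef (Merge 1 k) = qnum v k.+1.
Proof. by rewrite /= add1n qfactS qfact1; field; rewrite qfact_neq0. Qed.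

Lemma split0_k1 s k t : web_elt (split0 s k 1 t) = sym (sumn t) k.+1.
Proof.
case: k => [|k]; rewrite /split0 /= !web_eltE ?sym1 //.
by rewrite /layer_elt /= scale1r mulr1 addn1.
Qed.
Lemma split0_1k s k t : web_elt (split0 s 1 k t) = sym (sumn t) k.+1.
Proof.
case: k => [|k]; rewrite /split0 /= !web_eltE ?sym1 //.
by rewrite /layer_elt /= scale1r mulr1 add1n.
Qed.
Lemma merge0_k1 s k t : web_elt (merge0 s k 1 t) = qnum v k.+1 *: sym (sumn t) k.+1.
Proof.
case: k => [|k]; rewrite /merge0 /= !web_eltE; first by rewrite sym1 qnum1 scale1r.
by rewrite /layer_elt vertex_coefk1 mulr1 /= addn1.
Qed.
Lemma merge0_1k s k t : web_elt (merge0 s 1 k t) = qnum v k.+1 *: sym (sumn t) k.+1.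
Proof.
case: k => [|k]; rewrite /merge0 /= !web_eltE; first by rewrite sym1 qnum1 scale1r.
by rewrite /layer_elt vertex_coef1k mulr1 /= add1n.
Qed.

Lemma sumn_vdom h : sumn (vdom h) = vertex_size h.
Proof. by case: h => k l /=; rewrite ?addn0. Qed.
Lemma sumn_vcod h : sumn (vcod h) = vertex_size h.
Proof. by case: h => k l /=; rewrite ?addn0. Qed.
Lemma sumn_label0 k t : sumn (label0 k ++ t) = (k + sumn t)%N.
Proof. by case: k. Qed.

(** The symmetrizer in the middle of the first product is expanded by [symS], the
    one in the second product by [symSl]. Both expansions involve the generator
    between the two edges, and its contributions cancel. *)
Lemma web_square s k l t y : (0 < k)%N -> (0 < l)%N -> y = s ++ [:: k, l & t] ->
  syms y * web_elt (move_right s k l t ++ move_left s k.-1 l.+1 t) * syms y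
  - syms y * web_elt (move_left s k l t ++ move_right s k.+1 l.-1 t) * syms y
  = qnum v (k%:Z - l%:Z) *: (syms y * syms y).
Proof.
case: k l => [|k] [|l] // _ _ yE.
rewrite /move_right /move_left !web_elt_cat !split0_k1 !split0_1k !merge0_k1 !merge0_1k.
rewrite !sumn_label0 /=.
set o := sumn t; set S := syms y.
have inT i : (o <= i)%N -> (i.+1 < o + l.+1)%N -> inblock 0 y i.
  by move=> oi il; rewrite yE inblock_cat /= !add0n -/o oi il !orbT.
have inTk i : (l.+1 + o <= i)%N -> (i.+1 < l.+1 + o + k.+1)%N -> inblock 0 y i.
  by move=> oi il; rewrite yE inblock_cat /= !add0n -/o oi il !orbT.
have Sl : S * sym o l.+1 = S by apply: sym_fixr => i oi il; apply/syms_T/inT.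
have lS : sym o l.+1 * S = S by apply: sym_fixl => i oi il; apply/T_syms/inT.
have Sk : S * sym (l.+1 + o) k.+1 = S by apply: sym_fixr => i oi il; apply/syms_T/inTk.
have kS : sym (l.+1 + o) k.+1 * S = S by apply: sym_fixl => i oi il; apply/T_syms/inTk.
set a := sym (l.+1 + o) k.+1; set b := sym o l.+1; rewrite -/a in Sk kS; rewrite -/b in Sl lS.
set U := S * T (l + o)%N * S.
have E1 : S * (a * (qnum v l.+2 *: sym o l.+2) * (sym o l.+2 * (qnum v k.+1 *: a))) * S
    = qnum v k.+1 *: (v ^- l.+1 *: (S * S) + qnum v l.+1 *: U).
  rewrite -!mulrA -!scalerAl kS [S * _]mulrA Sk -!scalerAr scalerA mulrC -scalerA.
  rewrite [sym _ _ * (_ * _)]mulrA sym_absorbl //; congr (_ *: _); rewrite scalerAr scalerAl.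
  rewrite symS addnS /= addnC -/b mulrDl mulrDr -!scalerAl -!mulrA lS -!scalerAr [S * (b * _)]mulrA Sl.
  by rewrite /U mulrA.
have E2 : S * (b * (qnum v k.+2 *: sym (l + o) k.+2) * (sym (l + o) k.+2 * (qnum v l.+1 *: b))) * S
    = qnum v l.+1 *: (v ^- k.+1 *: (S * S) + qnum v k.+1 *: U).
  rewrite -!mulrA -!scalerAl lS [S * _]mulrA Sl -!scalerAr scalerA mulrC -scalerA.
  rewrite [sym _ _ * (_ * _)]mulrA sym_absorbl //; congr (_ *: _); rewrite scalerAr scalerAl.
  rewrite symSl -addSn -/a mulrDl mulrDr -!scalerAl -!mulrA kS -!scalerAr [S * (a * _)]mulrA Sk.
  by rewrite /U mulrA.
rewrite E1 E2 -qnumB !scalerDr !scalerA [qnum v l.+1 * qnum v _]mulrC opprD.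
by rewrite addrACA subrr addr0 -scalerBl.
Qed.

Lemma web_relation_eq0 r y y' : web_relation r ->
    all (fun cw : Qq * web_layers => is_diagram vdom vcod y cw.2 y') r ->
  syms y * (\sum_(cw <- r) g cw.1 *: web_elt cw.2) * syms y' = 0.
Proof.
case=> [_ _ [s a m b t]|s k l p t|s k l p t|s k l t|s k l t k0 l0] /= h;
  rewrite !big_cons big_nil /= ?rmorph1 ?rmorphN ?rmorph1 ?scaleN1r ?scale1r addr0.
- rewrite !web_eltE !mulr1 /layer_elt /= !sumn_cat !sumn_vdom !sumn_vcod.
  rewrite -!scalerAl -!scalerAr !scalerA [X in X *: _ - _]mulrC -scalerBr.
  rewrite [sym (sumn t) _ * _]sym_sym_comm; last by lia.
  by rewrite subrr scaler0 mulr0 mul0r.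
- rewrite !web_eltE !mulr1 /layer_elt -!scalerAl -!scalerAr !scalerA vertex_coefA /=.
  by rewrite !sym_absorbl ?addnA ?subrr ?mulr0 ?mul0r //; lia.
- rewrite !web_eltE !mulr1 /layer_elt /= !scale1r.
  by rewrite !sym_absorbr ?addnA ?subrr ?mulr0 ?mul0r //; lia.
- rewrite !web_eltE !mulr1 /layer_elt /= scale1r g_qbinom.
  case/andP: h => /andP[/eqP-> _] _; rewrite /bottom /=.
  rewrite -scalerAr sym_absorbl // scaleNr -scalerBr -scalerAr.
  rewrite mulrBr mulr1 syms_absorbr ?subrr ?scaler0 ?mul0r // => i ti ik.
  by rewrite inblock_cat /= !add0n ti ik orbT.
- case/and3P: h => h1 _ /andP[/eqP yy' _]; rewrite -{}yy' in h1 *.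
  have yE : y = s ++ [:: k, l & t].
    case: k l k0 l0 h1 => [|[|k]] [|l] // _ _ /andP[/eqP-> _];
    by rewrite /bottom /= ?cats0 ?addn1.
  rewrite scaleNr g_qint !mulrDr !mulrDl web_elt_nil !mulrN !mulNr addrA.
  by rewrite (web_square k0 l0 yE) -scalerAr mulr1 -scalerAl subrr.
Qed.

(** * Traces with the Markov property *)

(** Elements supported on the strands 0, ..., m, for which [T m] is the generator
    of a stabilization. *)
Inductive generated (m : nat) : A -> Prop :=
  | generated1 : generated m 1
  | generatedT i : (i < m)%N -> generated m (T i)
  | generatedZ c x : generated m x -> generated m (c *: x)
  | generatedD x y : generated m x -> generated m y -> generated m (x + y)
  | generatedM x y : generated m x -> generated m y -> generated m (x * y).

Lemma generated_sym m o k : (o + k <= m.+1)%N -> generated m (sym o k).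
Proof.
elim: k => [|[|k] IHk] ok; [by rewrite sym0; constructor|by rewrite sym1; constructor|].
have gk : generated m (sym o k.+1) by apply: IHk; lia.
rewrite -[sym _ _]scale1r -(mulVf (qnum_neq0 k.+1)) -scalerA symS.
apply/generatedZ/generatedD; apply: generatedZ => //.
apply/generatedM => //; apply: generatedM => //; apply: generatedT; lia.
Qed.

Lemma generated_syms m x : (sumn x <= m.+1)%N -> generated m (syms x).
Proof.
elim: x => [|k t IH] /=; first by constructor.
by move=> kt; apply: generatedM; [apply: generated_sym|apply: IH]; lia.
Qed.

Variables (alpha delta : K) (tau : {scalar A}).
Hypothesis alpha_neq0 : alpha != 0.
Hypothesis delta_neq0 : delta != 0.
Hypothesis deltaE : delta = (alpha - alpha^-1) / (v - v^-1).
Hypothesis tauC : forall x y, tau (x * y) = tau (y * x).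
Hypothesis tau1 : tau 1 = 1.
Hypothesis tau_markov : forall m x, generated m x ->
  delta * tau (x * T m) = - alpha^-1 * tau x.

(** The common form of the quantum binomials and of the values [c_wedge]: the
    i-th factor is the contribution of the strand added to i strands of an
    edge. *)
Definition circle_value (k : nat) : K :=
  \prod_(i < k) ((alpha * v ^- i - alpha^-1 * v ^+ i) / (v ^+ i.+1 - v ^- i.+1)).

Lemma generatedW m n x : (m <= n)%N -> generated m x -> generated n x.
Proof.
move=> mn; elim=> [|i im|c y _ IH|y z _ IHy _ IHz|y z _ IHy _ IHz].
- exact: generated1.
- by apply: generatedT; apply: leq_trans mn.
- exact: generatedZ.
- exact: generatedD.
- exact: generatedM.
Qed.

Lemma circle_value_step k :
  v ^- k * delta - alpha^-1 * qnum v k =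
  qnum v k.+1 * ((alpha * v ^- k - alpha^-1 * v ^+ k) / (v ^+ k.+1 - v ^- k.+1)).
Proof.
have v2 := subvV_neq0; have k2 := qnum_neq0 k.
have -> : v ^+ k.+1 - v ^- k.+1 = qnum v k.+1 * (v - v^-1) by rewrite qnumE -exprnN.
have -> : qnum v k = (v ^+ k - v ^- k) / (v - v^-1) by rewrite qnum.unlock -exprnN.
rewrite deltaE; move: (qnum v k.+1) (v - v^-1) (v ^+ k) (v ^- k) k2 v2 => n w x y n0 w0.
by field; rewrite n0 w0 alpha_neq0.
Qed.

(** Expanding by [symS], the term containing the new generator is evaluated by
    the Markov property after cyclic rotation. *)
Lemma tau_sym o k y :
    (forall i, (o <= i)%N -> GRing.comm y (T i)) -> generated o.-1 y ->
  delta ^+ k * tau (sym o k * y) = circle_value k * tau y.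
Proof.
move=> yT gy; elim: k => [|k IH].
  by rewrite sym0 mul1r expr0 /circle_value big_ord0.
apply: (mulfI (qnum_neq0 k)); rewrite /circle_value big_ord_recr -/(circle_value k) /=.
transitivity ((v ^- k * delta - alpha^-1 * qnum v k) * (delta ^+ k * tau (sym o k * y))); last first.
  by rewrite IH circle_value_step; ring.
rewrite mulrCA -[qnum _ _ * tau _]scalarZ scalerAl symS.
rewrite mulrDl -!scalerAl linearD /= !scalarZ exprS.
have [->|k0] := eqVneq k 0%N.
  by rewrite qnum0; ring.
have ys : y * sym o k = sym o k * y by apply: sym_comm => i oi _; apply: yT.
have gs : generated (o + k).-1 (y * sym o k).
  apply: generatedM; last by apply: generated_sym; lia.
  by apply: generatedW gy; lia.
have e : delta * tau (sym o k * T (o + k).-1 * sym o k * y) = - alpha^-1 * tau (sym o k * y).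
  rewrite -!mulrA -ys mulrA tauC mulrA.
  rewrite -[y * sym o k * sym o k]mulrA sym_absorbl //.
  by rewrite tau_markov // ys.
rewrite mulrDr [delta * _ * (qnum _ _ * _)](_ : _ =
  delta ^+ k * qnum v k * (delta * tau (sym o k * T (o + k).-1 * sym o k * y))).
  by rewrite e; ring.
by ring.
Qed.

Lemma tau_syms x : delta ^+ sumn x * tau (syms x) = \prod_(k <- x) circle_value k.
Proof.
elim: x => [|k t IH] /=; first by rewrite big_nil tau1 mul1r.
rewrite big_cons -IH exprD -mulrA [circle_value k * _]mulrCA -(@tau_sym (sumn t)).
- by rewrite [RHS]mulrCA.
- move=> i ti; apply/commr_sym/syms_comm => j /inblock_range [_ ji].
  by apply/commr_sym/T_comm; lia.
- by apply: generated_syms; lia.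
Qed.

(** The trace tau is normalized by [tau 1 = 1]; the power of delta restores the
    value of the strands that are closed up. *)
Definition web_trace (W : aweb) : K :=
  delta ^+ sumn W.1 * tau (syms W.1 * web_elt W.2).

Lemma is_diagram_catE x u w z : is_diagram vdom vcod x (u ++ w) z =
  is_diagram vdom vcod x u (last x [seq top vcod l | l <- u])
  && is_diagram vdom vcod (last x [seq top vcod l | l <- u]) w z.
Proof. by elim: u x => [|l u IH] x /=; rewrite ?eqxx // IH andbA. Qed.

(** The level at which a web [w] ending at [z] starts; with [is_diagram_catE] it
    locates the level of a local relation without a case analysis on its
    terms. *)
Definition source (w : web_layers) z := if w is l :: _ then bottom vdom l else z.

Lemma is_diagram_source x u w z : is_diagram vdom vcod x (u ++ w) z =
  is_diagram vdom vcod x u (source w z)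
  && is_diagram vdom vcod (source w z) w z.
Proof.
elim: u x => [|l u IH] x /=; last by rewrite IH andbA.
by case: w => [|l w] /=; rewrite eqxx ?andbT.
Qed.

Lemma web_sumn x w y : is_diagram vdom vcod x w y -> sumn x = sumn y.
Proof.
elim: w x => [|l w IH] x /=; first by move/eqP->.
case/andP=> /eqP-> /IH <-; rewrite /bottom /top !sumn_cat.
by rewrite sumn_vdom sumn_vcod.
Qed.

(** A local relation is replaced by its product with the idempotents of the
    levels around it, where [web_relation_eq0] applies; rotation is the cyclicity
    of tau. *)
Lemma annular_relation_trace z : annular_relation z -> mmap g web_trace z = 0.
Proof.
case=> [x u w r rr rw|x y u w].
  rewrite raddf_sum; set y := last x [seq top vcod l | l <- u]; set y' := source w x.
  have rr0 := @web_relation_eq0 r y y' rr.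
  have -> : \sum_(cw <- r) mmap g web_trace << cw.1 *g (x, u ++ cw.2 ++ w) : aweb >>
     = delta ^+ sumn x * tau (syms x * web_elt u *
        (syms y * (\sum_(cw <- r) g cw.1 *: web_elt cw.2) * syms y') * web_elt w).
    rewrite mulr_sumr mulr_suml mulr_sumr mulr_suml linear_sum mulr_sumr.
    apply: eq_big_seq => cw cwr; rewrite mmapU /web_trace /= mulrCA; congr (_ * _).
    rewrite -!scalerAr -!scalerAl -!scalerAr -!scalerAl scalarZ; congr (_ * tau _).
    have := allP rw _ cwr => /and3P[/=].
    rewrite is_diagram_catE -/y is_diagram_source -/y' => /and3P[xu uw _] _ _.
    by rewrite (web_elt_top uw) !web_elt_cat -!mulrA !mulrA (web_elt_top xu).
  rewrite rr0 ?mulr0 ?mul0r ?linear0 ?mulr0 //.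
  apply/allP=> cw /(allP rw) /and3P[/=].
  by rewrite is_diagram_catE -/y is_diagram_source -/y' => /and3P[].
case/and3P=> xu _ _ /and3P[yw _ _]; rewrite raddfB /= !mmapU /web_trace /= rmorph1 !mul1r.
rewrite (web_sumn xu) -mulrBr -linearB /= !web_elt_cat.
rewrite linearB /=.
suff -> : tau (syms x * (web_elt u * web_elt w)) =
          tau (syms y * (web_elt w * web_elt u)) by rewrite subrr mulr0.
by rewrite !mulrA -(web_elt_top xu) -(web_elt_top yw) -mulrA tauC !mulrA.
Qed.

Lemma annular_null_trace z : annular_null z -> mmap g web_trace z = 0.
Proof.
elim=> [|c x y _ xr _ y0]; first exact: mmap0.
by rewrite mmapD y0 addr0 mmap_scale annular_relation_trace // mulr0.
Qed.

(** * The bracket of a braid *)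

Definition letter_elt (c : nat * bool) : A :=
  if c.2 then T c.1 else T c.1 - (v - v^-1)%:A.

(** Position i from the left on N strands has N - i - 2 strands to the right of
    the crossing. *)
Definition letters N (beta : braid N) : seq (nat * bool) :=
  [seq ((N - c.1.+2)%N, c.2) | c : 'I_N.-1 * bool <- beta].

Lemma E_web_elt N i : web_elt (E_web N i) = v^-1%:A + T (N - i.+2).
Proof.
have sn n : sumn (nseq n 1) = n by rewrite sumn_nseq mul1n.
rewrite /E_web !web_eltE /layer_elt vertex_coef1k /= scale1r mulr1 !sn.
rewrite -scalerAl sym_absorbl // symS sym1 !mulr1 mul1r expr1 qnum1 scale1r.
by rewrite addn1.
Qed.

Lemma bracket_elt N (beta : braid N) :
  \sum_(cw <- bracket beta) g cw.1 *: web_elt cw.2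
  = \prod_(c <- letters beta) letter_elt c.
Proof.
elim: beta => [|[i b] beta IH] /=.
  by rewrite big_seq1 big_nil /= rmorph1 web_elt_nil scale1r.
rewrite big_cons -IH big_cat !big_map /= mulr_sumr -big_split.
have wE w : web_elt (E_web N i ++ w) = (v^-1%:A + T (N - i.+2)) * web_elt w.
  by rewrite web_elt_cat E_web_elt.
apply: eq_bigr => cw _; rewrite (wE cw.2).
have e : (g (if b then - q else - q^-1))%:A + (v^-1%:A + T (N - i.+2))
       = letter_elt ((N - i.+2)%N, b).
  case: b; rewrite rmorphN ?fmorphV g_q ?invrK /letter_elt /=.
    by rewrite scaleNr addrA addNr add0r.
  by rewrite scalerBl opprB addrA scaleNr addrC [- _ + _]addrC.
rewrite -e [RHS]mulrDl rmorphM [LHS]/=; congr (_ + _); last by rewrite scalerAr.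
by rewrite -[in RHS]scalerAl mul1r scalerA.
Qed.

Lemma annular_bracket_trace N (beta : braid N) :
  mmap g web_trace (annular_bracket beta)
  = delta ^+ N * tau (\prod_(c <- letters beta) letter_elt c).
Proof.
rewrite -bracket_elt /annular_bracket [LHS]raddf_sum linear_sum mulr_sumr /=; apply: eq_bigr => cw _.
rewrite mmapU scalarZ /web_trace /= syms_ones mul1r sumn_nseq mul1n.
by rewrite mulrCA.
Qed.

Lemma circle_webs_trace (C : circle_sum) :
  mmap g web_trace (circle_webs C)
  = \sum_(s <- msupp C) g C@_s * \prod_(k <- s) circle_value k.
Proof.
rewrite /circle_webs [LHS]raddf_sum /=; apply: eq_bigr => s _; rewrite mmapU /web_trace /=.
by rewrite web_elt_nil mulr1 tau_syms.
Qed.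

Lemma braid_trace_circles N (beta : braid N) (C : circle_sum) :
  annular_null (annular_bracket beta - circle_webs C) ->
  delta ^+ N * tau (\prod_(c <- letters beta) letter_elt c)
  = \sum_(s <- msupp C) g C@_s * \prod_(k <- s) circle_value k.
Proof.
move/annular_null_trace; rewrite mmapB annular_bracket_trace circle_webs_trace.
by move/eqP; rewrite subr_eq0 => /eqP.
Qed.

End Hecke.

(** * Isotopies of closed braids *)

Lemma nseq_push (b : bool) n s : nseq n b ++ b :: s = b :: nseq n b ++ s.
Proof. by elim: n => //= n ->. Qed.

Lemma nseq_cat (b : bool) m n s : nseq m b ++ nseq n b ++ s = nseq (m + n) b ++ s.
Proof. by rewrite catA -nseqD. Qed.

Local Notation dia := (is_diagram tdom tcod).

Lemma link_diagram_inj (D D' : link_diagram) :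
  link_layers D = link_layers D' -> D = D'.
Proof.
case: D D' => w h [w' h'] /= e; case: _ / e in h' *.
by rewrite (bool_irrelevance h h').
Qed.

Section Isotopy.
Variables (K : Type) (P : link_diagram -> K).
Hypothesis P_inv : link_invariant P.

(** Diagrams from [x] to [y] on which [P] takes the same value in every closed
    diagram; keeping the two ends in the relation makes it transitive, as the
    intermediate diagrams are then closed as well. *)
Record isotopic (x : seq bool) (A B : seq (layer bool tangle)) (y : seq bool) : Prop :=
  Isotopic {
    isotopicl : dia x A y;
    isotopicr : dia x B y;
    isotopicE : forall u v (D D' : link_diagram), link_layers D = u ++ A ++ v ->
      link_layers D' = u ++ B ++ v -> dia [::] u x -> dia y v [::] -> P D = P D' }.

Lemma isotopic_refl x A y : dia x A y -> isotopic x A A y.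
Proof.
by move=> h; split=> // u v D D' DE D'E _ _; congr P; apply: link_diagram_inj; rewrite DE.
Qed.

Lemma isotopic_sym x A B y : isotopic x A B y -> isotopic x B A y.
Proof.
case=> hA hB h; split=> // u v D D' DE D'E hu hv.
by apply/esym/(h u v).
Qed.

Lemma isotopic_trans x A B C y :
  isotopic x A B y -> isotopic x B C y -> isotopic x A C y.
Proof.
case=> hA hB h [_ hC h']; split=> // u v D D' DE D'E hu hv.
have cB : dia [::] (u ++ B ++ v) [::].
  by apply: is_diagram_cat hu _; apply: is_diagram_cat hB hv.
by rewrite (h u v D (LinkDiagram cB)) //; apply: (h' u v).
Qed.

Lemma isotopic_cat x A A' y B B' z : isotopic x A A' y -> isotopic y B B' z ->
  isotopic x (A ++ B) (A' ++ B') z.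
Proof.
case=> hA hA' h [hB hB' h']; split; [exact: is_diagram_cat hB|exact: is_diagram_cat hB'|].
move=> u v D D' DE D'E hu hv.
have c : dia [::] (u ++ A' ++ B ++ v) [::].
  by do 2![apply: is_diagram_cat; first by eassumption]; apply: is_diagram_cat hv.
rewrite (h u (B ++ v) D (LinkDiagram c)) ?DE ?catA //; last exact: is_diagram_cat hv.
apply: (h' (u ++ A') v) => //=; rewrite ?D'E ?catA //.
exact: is_diagram_cat hA'.
Qed.

Lemma isotopic_catl x A y B B' z : dia x A y -> isotopic y B B' z ->
  isotopic x (A ++ B) (A ++ B') z.
Proof. by move=> /isotopic_refl; apply: isotopic_cat. Qed.

Lemma isotopic_catr x A A' y B z : isotopic x A A' y -> dia y B z ->
  isotopic x (A ++ B) (A' ++ B) z.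
Proof. by move=> h /isotopic_refl; apply: isotopic_cat. Qed.

Lemma move_dia A B x y : isotopy_move A B -> dia x A y -> dia x B y.
Proof.
case=> [_ _ [s g m h t]|s o t|s o t|s b o p t|s b o p t|s b o t|s b o t|s b o1 o2 t
  |s b12 b13 b23 o1 o2 o3 t _] /=; rewrite /bottom /top /= -?catA /= ?negbK;
  by do ?[case/andP=> /eqP->]; rewrite -?catA ?eqxx.
Qed.

Lemma isotopic_move A B x y : isotopy_move A B -> dia x A y -> isotopic x A B y.
Proof.
move=> m h; split=> //; first exact: move_dia m h.
by move=> u v D D' DE D'E _ _; apply: P_inv m DE D'E.
Qed.

Local Notation f := false.
Local Notation t := true.

(** A crossing of two upward strands is carried past two nested caps: each strand
    slides past one cap, and between the two slides the caps are exchanged in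
    height. *)
Lemma double_cap_slide s b r :
  isotopic (s ++ [:: f, f, t, t & r])
    [:: (s ++ [:: f; f], Crossing b t t, r); (s ++ [:: f], Cap f, t :: r); (s, Cap f, r)]
    [:: (s, Crossing b f f, [:: t, t & r]); (s ++ [:: f], Cap f, t :: r); (s, Cap f, r)]
    (s ++ r).
Proof.
pose A1 := [:: (s ++ [:: f], Crossing (~~ b) f t, t :: r);
               (s ++ [:: f; t], Cap f, r); (s, Cap f, r)].
pose A2 := [:: (s ++ [:: f], Crossing (~~ b) f t, t :: r);
               (s, Cap f, [:: f, t & r]); (s, Cap f, r)].
apply: (isotopic_trans (B := A1)).
  apply: (isotopic_catr (A := [:: _; _]) (A' := [:: _; _]) (y := (s ++ [:: f, t & r])) (B := [:: _])).
    apply: isotopic_sym; apply: isotopic_move.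
      by have := SlideCap (s ++ [:: f]) (~~ b) f t r; rewrite -?catA /= negbK.
    by rewrite /= /bottom /top /= -?catA /= !eqxx.
  by rewrite /= /bottom /top /= !eqxx.
apply: (isotopic_trans (B := A2)).
  apply: (isotopic_catl (A := [:: _]) (y := (s ++ [:: f, t, f, t & r])) (B := [:: _; _]) (B' := [:: _; _])).
    by rewrite /= /bottom /top /= -?catA /= !eqxx.
  apply: isotopic_sym; apply: isotopic_move.
    have := TangleExchange (HeightExchange tdom tcod s (Cap f) [::] (Cap f) r).
    by rewrite /= !cats0; exact.
  by rewrite /= /bottom /top /= -?catA /= !eqxx.
apply: (isotopic_catr (A := [:: _; _]) (A' := [:: _; _]) (y := (s ++ [:: f, t & r])) (B := [:: _])).
  apply: isotopic_sym; apply: isotopic_move.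
    exact: (SlideCap s b f f (t :: r)).
  by rewrite /= /bottom /top /= -?catA /= !eqxx.
by rewrite /= /bottom /top /= !eqxx.
Qed.

Lemma double_cup_slide s b r :
  isotopic (s ++ r)
    [:: (s, Cup f, r); (s ++ [:: f], Cup f, t :: r); (s, Crossing b f f, [:: t, t & r])]
    [:: (s, Cup f, r); (s ++ [:: f], Cup f, t :: r); (s ++ [:: f; f], Crossing b t t, r)]
    (s ++ [:: f, f, t, t & r]).
Proof.
pose A1 := [:: (s, Cup f, r); (s, Cup f, [:: f, t & r]);
               (s ++ [:: f], Crossing (~~ b) t f, t :: r)].
pose A2 := [:: (s, Cup f, r); (s ++ [:: f; t], Cup f, r); 
               (s ++ [:: f], Crossing (~~ b) t f, t :: r)].
apply: (isotopic_trans (B := A1)).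
  apply: (isotopic_catl (A := [:: _]) (y := (s ++ [:: f, t & r])) (B := [:: _; _]) (B' := [:: _; _])).
    by rewrite /= /bottom /top /= !eqxx.
  apply: isotopic_move.
    exact: (SlideCup s b f f (t :: r)).
  by rewrite /= /bottom /top /= -?catA /= !eqxx.
apply: (isotopic_trans (B := A2)).
  apply: (isotopic_catr (A := [:: _; _]) (A' := [:: _; _]) (y := (s ++ [:: f, t, f, t & r])) (B := [:: _])).
    apply: isotopic_sym; apply: isotopic_move.
      have := TangleExchange (HeightExchange tdom tcod s (Cup f) [::] (Cup f) r).
      by rewrite /= !cats0; exact.
    by rewrite /= /bottom /top /= -?catA /= !eqxx.
  by rewrite /= /bottom /top /= -?catA /= !eqxx.
apply: (isotopic_catl (A := [:: _]) (y := (s ++ [:: f, t & r])) (B := [:: _; _]) (B' := [:: _; _])).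
  by rewrite /= /bottom /top /= !eqxx.
apply: isotopic_move.
  by have := SlideCup (s ++ [:: f]) (~~ b) f t r; rewrite -?catA /= negbK.
by rewrite /= /bottom /top /= -?catA /= !eqxx.
Qed.

(** The crossing slides off the cap to become a Reidemeister curl of the cup; the
    zigzag that is left is straightened. *)
Lemma kink s b r :
  isotopic (s ++ t :: r)
    [:: (s, Cup f, t :: r); (s ++ [:: f], Crossing b t t, r); (s, Cap f, t :: r)]
    [::] (s ++ t :: r).
Proof.
pose A1 := [:: (s, Cup f, t :: r); (s, Crossing (~~ b) f t, t :: r); (s ++ [:: t], Cap f, r)].
pose A2 := [:: (s, Cup t, t :: r); (s ++ [:: t], Cap f, r)].
apply: (isotopic_trans (B := A1)).
  apply: (isotopic_catl (A := [:: _]) (y := (s ++ [:: f, t, t & r])) (B := [:: _; _]) (B' := [:: _; _])).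
    by rewrite /= /bottom /top /= !eqxx.
  apply: isotopic_sym; apply: isotopic_move.
    by have := SlideCap s (~~ b) f t r; rewrite negbK.
  by rewrite /= /bottom /top /= -?catA /= !eqxx.
apply: (isotopic_trans (B := A2)).
  apply: (isotopic_catr (A := [:: _; _]) (A' := [:: _]) (y := (s ++ [:: t, f, t & r])) (B := [:: _])).
    apply: isotopic_move; first exact: (Reidemeister1Cup s (~~ b) f (t :: r)).
    by rewrite /= /bottom /top /= -?catA /= !eqxx.
  by rewrite /= /bottom /top /= -?catA /= !eqxx.
apply: isotopic_move; first exact: (ZigzagR s t r).
by rewrite /= /bottom /top /= -?catA /= !eqxx.
Qed.

Definition updown n := nseq n f ++ nseq n t.

Fixpoint cups n : seq (layer bool tangle) :=
  if n is n'.+1 then cups n' ++ [:: (nseq n' f, Cup f, nseq n' t)] else [::].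
Fixpoint caps n : seq (layer bool tangle) :=
  if n is n'.+1 then (nseq n' f, Cap f, nseq n' t) :: caps n' else [::].

(** The crossing of two upward strands with c.1 strands to their right; the
    downward crossing below is its image on the closing strands. *)
Definition up_crossing n (c : nat * bool) : layer bool tangle :=
  (nseq n f ++ nseq (n - c.1.+2) t, Crossing c.2 t t, nseq c.1 t).
Definition down_crossing n (c : nat * bool) : layer bool tangle :=
  (nseq c.1 f, Crossing c.2 f f, nseq (n - c.1.+2) f ++ nseq n t).

Lemma dia_cups n : dia [::] (cups n) (updown n).
Proof.
elim: n => //= n IH; apply: is_diagram_cat IH _.
by rewrite /= /bottom /top /updown /= !nseq_push !eqxx.
Qed.

Lemma dia_caps n : dia (updown n) (caps n) [::].
Proof.
elim: n => //= n IH; rewrite /top /= -/(updown n) IH andbT.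
by rewrite /bottom /updown /= !nseq_push.
Qed.

Lemma dia_up n c : (c.1.+1 < n)%N -> dia (updown n) [:: up_crossing n c] (updown n).
Proof.
move=> cn; have [d ->] : exists d, n = (d + c.1.+2)%N by exists (n - c.1.+2)%N; lia.
by rewrite /= /bottom /top /up_crossing /updown /= addnK !nseqD /= -!catA !eqxx.
Qed.

Lemma dia_down n c : (c.1.+1 < n)%N -> dia (updown n) [:: down_crossing n c] (updown n).
Proof.
move=> cn; have [d ->] : exists d, n = (c.1.+2 + d)%N by exists (n - c.1.+2)%N; lia.
rewrite /= /bottom /top /down_crossing /updown /= addKn !nseq_push !nseq_cat.
by rewrite !eqxx.
Qed.

Lemma up_cap_exchange j b d n : n = (j + d).+2 ->
  isotopic (updown n.+1)
    [:: up_crossing n.+1 (j, b); (nseq n f, Cap f, nseq n t)]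
    [:: (nseq n f, Cap f, nseq n t); up_crossing n (j, b)] (updown n).
Proof.
move=> nE; have e : (n.+1 - j.+2 = d.+1)%N by lia.
have e' : (n - j.+2 = d)%N by lia.
have := TangleExchange (HeightExchange tdom tcod (nseq n f) (Cap f) (nseq d t)
  (Crossing b t t) (nseq j t)).
rewrite /= !nseq_push ?nseq_cat -?nseqD => m; apply: isotopic_sym; apply: isotopic_move.
  have -> : nseq n t = [:: t, t & nseq (d + j) t] by rewrite nE addnC.
  by rewrite /up_crossing /= e e'.
rewrite /= /bottom /top /up_crossing /updown /= e' -?catA /= !nseq_push -?nseqD.
by rewrite (_ : nseq n t = [:: t, t & nseq (d + j) t]) ?eqxx // nE addnC.
Qed.

Lemma down_cap_exchange j b d n : n = (j + d).+2 ->
  isotopic (updown n.+1)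
    [:: down_crossing n.+1 (j, b); (nseq n f, Cap f, nseq n t)]
    [:: (nseq n f, Cap f, nseq n t); down_crossing n (j, b)] (updown n).
Proof.
move=> nE; have e : (n.+1 - j.+2 = d.+1)%N by lia.
have e' : (n - j.+2 = d)%N by lia.
have := TangleExchange (HeightExchange tdom tcod (nseq j f) (Crossing b f f) (nseq d f)
  (Cap f) (nseq n t)).
rewrite /= !nseq_push ?nseq_cat -?nseqD => m; apply: isotopic_move.
  have -> : nseq n f = [:: f, f & nseq (j + d) f] by rewrite nE.
  by rewrite /down_crossing /= e e' -?catA /= ?nseq_push.
rewrite /= /bottom /top /down_crossing /updown /= e -?catA /= ?nseq_push ?nseq_cat -?nseqD.
by rewrite (_ : nseq n f = [:: f, f & nseq (j + d) f]) /= ?addnS ?nseq_push ?eqxx // nE.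
Qed.

Lemma up_cup_exchange j b d n : n = (j + d).+2 ->
  isotopic (updown n)
    [:: (nseq n f, Cup f, nseq n t); up_crossing n.+1 (j, b)]
    [:: up_crossing n (j, b); (nseq n f, Cup f, nseq n t)]
    (updown n.+1).
Proof.
move=> nE; have e : (n.+1 - j.+2 = d.+1)%N by lia.
have e' : (n - j.+2 = d)%N by lia.
have := TangleExchange (HeightExchange tdom tcod (nseq n f) (Cup f) (nseq d t)
  (Crossing b t t) (nseq j t)).
rewrite /= !nseq_push ?nseq_cat -?nseqD => m; apply: isotopic_move.
  have -> : nseq n t = [:: t, t & nseq (d + j) t] by rewrite nE addnC.
  by rewrite /up_crossing /= e e'.
rewrite /= /bottom /top /up_crossing /updown /= e -?catA /= ?nseq_push ?nseq_cat -?nseqD.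
by rewrite (_ : nseq n t = [:: t, t & nseq (d + j) t]) /= ?nseq_push ?eqxx // nE addnC.
Qed.

Lemma down_cup_exchange j b d n : n = (j + d).+2 ->
  isotopic (updown n)
    [:: (nseq n f, Cup f, nseq n t); down_crossing n.+1 (j, b)]
    [:: down_crossing n (j, b); (nseq n f, Cup f, nseq n t)]
    (updown n.+1).
Proof.
move=> nE; have e : (n.+1 - j.+2 = d.+1)%N by lia.
have e' : (n - j.+2 = d)%N by lia.
have := TangleExchange (HeightExchange tdom tcod (nseq j f) (Crossing b f f) (nseq d f)
  (Cup f) (nseq n t)).
rewrite /= !nseq_push ?nseq_cat -?nseqD => m; apply: isotopic_sym; apply: isotopic_move.
  have -> : nseq n f = [:: f, f & nseq (j + d) f] by rewrite nE.
  by rewrite /down_crossing /= e e' -?catA /= ?nseq_push.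
rewrite /= /bottom /top /down_crossing /updown /= e' -?catA /= ?nseq_push ?nseq_cat -?nseqD.
by rewrite (_ : nseq n f = [:: f, f & nseq (j + d) f]) /= ?addnS ?nseq_push ?eqxx // nE.
Qed.

Lemma down_up_exchange n c c' : (c.1.+1 < n)%N -> (c'.1.+1 < n)%N ->
  isotopic (updown n) [:: up_crossing n c; down_crossing n c']
    [:: down_crossing n c'; up_crossing n c] (updown n).
Proof.
case: c c' => j b [i a] /= jn im.
have [d nE] : exists d, n = (j + d).+2 by exists (n - j.+2)%N; lia.
have [d' nE'] : exists d, n = (i + d).+2 by exists (n - i.+2)%N; lia.
have := TangleExchange (HeightExchange tdom tcod (nseq i f) (Crossing a f f)
  (nseq d' f ++ nseq d t) (Crossing b t t) (nseq j t)).
have e : (n - j.+2 = d)%N by lia.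
have e' : (n - i.+2 = d')%N by lia.
have tE : nseq n t = [:: t, t & nseq (d + j) t] by rewrite nE addnC.
have fE : nseq n f = [:: f, f & nseq (i + d') f] by rewrite nE'.
rewrite /= -?catA /= !nseq_push ?nseq_cat -?nseqD => m.
apply: isotopic_sym; apply: isotopic_move.
  by rewrite /down_crossing /up_crossing /= e e' tE fE.
rewrite /= /bottom /top /down_crossing /up_crossing /updown /= e e'.
by rewrite tE fE -?catA /= ?nseq_push ?nseq_cat -?nseqD !eqxx.
Qed.

Lemma up_up_exchange n c c' : (c.1.+1 < n)%N -> (c'.1.+1 < c.1)%N ->
  isotopic (updown n) [:: up_crossing n c; up_crossing n c']
    [:: up_crossing n c'; up_crossing n c] (updown n).
Proof.
case: c c' => j b [i a] /= jn ij.
have [d nE] : exists d, n = (j + d).+2 by exists (n - j.+2)%N; lia.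
have [e jE] : exists e, j = (e + i).+2 by exists (j - i.+2)%N; lia.
have := TangleExchange (HeightExchange tdom tcod (nseq n f ++ nseq d t) (Crossing b t t)
  (nseq e t) (Crossing a t t) (nseq i t)).
have dE : (n - j.+2 = d)%N by lia.
have iE : (n - i.+2 = (d + e).+2)%N by lia.
have tE : nseq n t = [:: t, t & nseq (d + j) t] by rewrite nE addnC.
have jtE : nseq j t = [:: t, t & nseq (e + i) t] by rewrite jE.
rewrite /= -?catA /= !nseq_push ?nseq_cat -?nseqD => m.
apply: isotopic_move; first by rewrite /up_crossing /= dE iE jtE.
rewrite /= /bottom /top /up_crossing /updown /= dE iE -?catA /=.
by rewrite tE jtE ?nseq_push ?nseq_cat -?nseqD jE ?addnS ?addnA !eqxx.
Qed.

Lemma up_braid n i : (i.+2 < n)%N ->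
  isotopic (updown n)
    [:: up_crossing n (i.+1, true); up_crossing n (i, true); up_crossing n (i.+1, true)]
    [:: up_crossing n (i, true); up_crossing n (i.+1, true); up_crossing n (i, true)]
    (updown n).
Proof.
move=> jn; have [d nE] : exists d, n = (i + d).+3 by exists (n - i.+3)%N; lia.
have dE : (n - i.+3 = d)%N by lia.
have iE : (n - i.+2 = d.+1)%N by lia.
have tE : nseq n t = [:: t, t, t & nseq (d + i) t] by rewrite nE addnC.
have := @Reidemeister3 (nseq n f ++ nseq d t) true true true true true true (nseq i t) isT.
rewrite /= -?catA /= !nseq_push cats0 => m.
apply: isotopic_move; first by rewrite /up_crossing /= dE iE.
rewrite /= /bottom /top /up_crossing /updown /= dE iE -?catA /=.
by rewrite tE ?nseq_push ?nseq_cat -?nseqD !eqxx.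
Qed.

Lemma up_inverse n j b : (j.+1 < n)%N ->
  isotopic (updown n) [:: up_crossing n (j, b); up_crossing n (j, ~~ b)] [::] (updown n).
Proof.
move=> jn; apply: isotopic_move; first exact: Reidemeister2.
have h b' := @dia_up n (j, b') jn.
exact: (@is_diagram_cat _ _ _ _ _ [:: _] _ [:: _] _ (h b) (h (~~ b))).
Qed.

(** The caps inside the crossing are passed by exchanging heights, until the two
    caps of the crossing strands are innermost. *)
Lemma cap_slide n c : (c.1.+1 < n)%N ->
  isotopic (updown n) (up_crossing n c :: caps n) (down_crossing n c :: caps n) [::].
Proof.
case: c => j b; elim: n => [|n IH] //=.
rewrite ltnS leq_eqVlt => /orP[/eqP nE | jn].
  have := @double_cap_slide (nseq j f) b (nseq j t).
  rewrite -nE /= /up_crossing /down_crossing /updown /= subnn !nseq_push !cats0 => h.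
  apply: (isotopic_catr (A := [:: _; _; _]) (A' := [:: _; _; _])).
    exact: h.
  exact: dia_caps.
have [d nE] : exists d, n = (j + d).+2 by exists (n - j.+2)%N; lia.
apply: isotopic_trans.
  apply: (isotopic_catr (A := [:: _; _]) (A' := [:: _; _])); last exact: dia_caps.
  exact: up_cap_exchange nE.
apply: isotopic_trans.
  apply: (isotopic_catl (A := [:: _])); last exact: IH.
  by rewrite /= /bottom /top /updown /= ?nseq_push !eqxx.
apply: isotopic_sym.
apply: (isotopic_catr (A := [:: _; _]) (A' := [:: _; _])); last exact: dia_caps.
exact: down_cap_exchange nE.
Qed.

Lemma cup_slide n c : (c.1.+1 < n)%N ->
  isotopic [::] (cups n ++ [:: down_crossing n c]) (cups n ++ [:: up_crossing n c]) (updown n).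
Proof.
case: c => j b; elim: n => [|n IH] //=.
rewrite ltnS leq_eqVlt => /orP[/eqP nE | jn].
  have := @double_cup_slide (nseq j f) b (nseq j t).
  rewrite -nE /= /up_crossing /down_crossing /updown /= subnn !nseq_push !cats0 => h.
  by rewrite -!catA; apply: isotopic_catl h; apply: dia_cups.
have [d nE] : exists d, n = (j + d).+2 by exists (n - j.+2)%N; lia.
rewrite -!catA /=; apply: isotopic_trans.
  by apply: isotopic_catl; [exact: dia_cups|exact: down_cup_exchange nE].
rewrite -cat1s catA; apply: isotopic_trans.
  apply: isotopic_catr; first exact: IH.
  by rewrite /= /bottom /top /updown /= ?nseq_push !eqxx.
rewrite -catA; apply/isotopic_sym/isotopic_catl; first exact: dia_cups.
exact: up_cup_exchange nE.
Qed.

(** * Conjugation and stabilization of closures *)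

Definition word_layers n (w : seq (nat * bool)) := [seq up_crossing n c | c <- w].
Definition closed_word n w := cups n ++ word_layers n w ++ caps n.
Definition on_strands n (w : seq (nat * bool)) := all (fun c => c.1.+1 < n)%N w.

Lemma dia_word n w : on_strands n w -> dia (updown n) (word_layers n w) (updown n).
Proof.
elim: w => [|c w IH] /=; first by rewrite eqxx.
by case/andP=> cn /IH; apply: (@is_diagram_cat _ _ _ _ _ [:: _]); apply: dia_up.
Qed.

Lemma dia_closure n w : on_strands n w -> dia [::] (closed_word n w) [::].
Proof.
move=> wn; apply: is_diagram_cat (dia_cups n) _.
by apply: is_diagram_cat (dia_word wn) _; apply: dia_caps.
Qed.

Definition closure_link n w : link_diagram :=
  if decP (@idP (dia [::] (closed_word n w) [::])) is left h then LinkDiagram h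
  else unknot.

Lemma closure_linkE n w : on_strands n w -> link_layers (closure_link n w) = closed_word n w.
Proof. by move/dia_closure=> h; rewrite /closure_link; case: (decP _). Qed.

(** Local isotopies of the braid may be applied inside its closure. *)
Lemma isotopic_closure n u u' w w' : on_strands n (w ++ u ++ w') -> on_strands n u' ->
    isotopic (updown n) (word_layers n u) (word_layers n u') (updown n) ->
  P (closure_link n (w ++ u ++ w')) = P (closure_link n (w ++ u' ++ w')).
Proof.
rewrite /on_strands !all_cat => /and3P[wn un wn'] un' [_ _ h].
apply: (h (cups n ++ word_layers n w) (word_layers n w' ++ caps n)).
- by rewrite closure_linkE /on_strands ?all_cat ?wn ?un // /closed_word /word_layers !map_cat -!catA.
- by rewrite closure_linkE /on_strands ?all_cat ?wn ?un' // /closed_word /word_layers !map_cat -!catA.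
- by apply: is_diagram_cat (dia_cups n) _; apply: dia_word.
- by apply: is_diagram_cat (dia_word wn') _; apply: dia_caps.
Qed.

Lemma word_down_exchange n w c : on_strands n w -> (c.1.+1 < n)%N ->
  isotopic (updown n) (word_layers n w ++ [:: down_crossing n c])
    (down_crossing n c :: word_layers n w) (updown n).
Proof.
move=> wn cn; elim: w wn => [|c' w IH] /=.
  by move=> _; apply: isotopic_refl; apply: dia_down.
case/andP=> cn' wn; apply: isotopic_trans.
  apply: (isotopic_catl (A := [:: _])); first exact: dia_up.
  exact: IH.
apply: (isotopic_catr (A := [:: _; _]) (A' := [:: _; _])); last exact: dia_word.
exact: down_up_exchange.
Qed.

(** The last crossing is slid past the caps, down along the closing strands, and
    through the cups to the bottom of the braid. *)
Lemma closure_conjugate n w c : on_strands n (c :: w) ->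
  P (closure_link n (w ++ [:: c])) = P (closure_link n (c :: w)).
Proof.
move=> cwn; have /andP[cn wn] := cwn.
have h : isotopic [::] (closed_word n (w ++ [:: c])) (closed_word n (c :: w)) [::].
  rewrite /closed_word /word_layers map_cat -!catA /= -/(word_layers n w).
  apply: isotopic_trans.
    apply: isotopic_catl; first exact: dia_cups.
    by apply: isotopic_catl; [exact: dia_word|exact: cap_slide].
  rewrite -(cat1s (down_crossing n c)) -(cat1s (up_crossing n c)).
  rewrite (catA (word_layers n w) [:: down_crossing n c]); apply: isotopic_trans.
    apply: isotopic_catl; first exact: dia_cups.
    by apply: isotopic_catr; [exact: word_down_exchange|exact: dia_caps].
  rewrite -cat1s -catA !catA -!(catA _ (word_layers n w)).
  apply: isotopic_catr; first exact: cup_slide.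
  by apply: is_diagram_cat (dia_word wn) _; apply: dia_caps.
apply: (isotopicE h (u := [::]) (v := [::])); rewrite ?cats0 ?closure_linkE //.
by rewrite /on_strands all_cat -/(on_strands n w) (wn : on_strands n w) /= cn.
Qed.

Lemma word_cup_exchange n w : on_strands n w ->
  isotopic (updown n)
    ((nseq n f, Cup f, nseq n t) :: word_layers n.+1 w)
    (word_layers n w ++ [:: (nseq n f, Cup f, nseq n t)]) (updown n.+1).
Proof.
elim: w => [|[j b] w IH] /=.
  by move=> _; apply: isotopic_refl; rewrite /= /bottom /top /updown /= ?nseq_push !eqxx.
case/andP=> cn wn; have [d nE] : exists d, n = (j + d).+2 by exists (n - j.+2)%N; lia.
apply: isotopic_trans.
  apply: (isotopic_catr (A := [:: _; _]) (A' := [:: _; _])); last first.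
    by apply: dia_word; apply: sub_all wn => c /leqW.
  exact: up_cup_exchange nE.
apply: (isotopic_catl (A := [:: _])); first exact: dia_up.
exact: IH.
Qed.

(** The cup of the innermost strand is lifted above [w], which does not involve
    that strand; what remains between it and its cap is a kink. *)
Lemma closure_stabilize n w b : on_strands n.+1 w ->
  P (closure_link n.+2 (w ++ [:: (n, b)])) = P (closure_link n.+1 w).
Proof.
move=> wn; have wn' : on_strands n.+2 w by apply: sub_all wn => c /leqW.
have h : isotopic [::] (closed_word n.+2 (w ++ [:: (n, b)])) (closed_word n.+1 w) [::].
  have -> : closed_word n.+2 (w ++ [:: (n, b)]) = cups n.+1 ++
      ((nseq n.+1 f, Cup f, nseq n.+1 t) :: word_layers n.+2 w)
      ++ [:: up_crossing n.+2 (n, b)] ++ caps n.+2.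
    by rewrite /closed_word /word_layers map_cat /= -!catA.
  apply: isotopic_catl; first exact: dia_cups.
  apply: isotopic_trans.
    apply: isotopic_catr; first exact: word_cup_exchange.
    apply: (@is_diagram_cat _ _ _ _ _ [:: _]); last exact: dia_caps.
    exact: dia_up.
  rewrite -!catA; apply: isotopic_catl; first exact: dia_word.
  apply: (isotopic_catr (A := [:: _; _; _]) (A' := [::]) (y := updown n.+1) (B := caps n.+1)); last exact: dia_caps.
  have := kink (nseq n.+1 f) b (nseq n t).
  by rewrite /up_crossing subnn cats0 /updown /= !nseq_push cats0.
apply: (isotopicE h (u := [::]) (v := [::])); rewrite ?cats0 ?closure_linkE //.
by rewrite /on_strands all_cat -/(on_strands n.+2 w) wn' /= !ltnS leqnn.
Qed.

End Isotopy.

(** * The Markov trace of a skein invariant *)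

Section SkeinInvariant.
Variables (K : fieldType) (v alpha delta : K) (P : link_diagram -> K).
Hypothesis alpha_neq0 : alpha != 0.
Hypothesis deltaE : delta = (alpha - alpha^-1) / (v - v^-1).
Hypothesis delta_neq0 : delta != 0.
Hypothesis P_inv : link_invariant P.
Hypothesis P_skein : skein_relation alpha^-1 alpha (v^-1 - v) P.
Hypothesis P_unknot : P unknot = delta.

(** Both stabilizations of the closure are isotopic to it, so the skein relation
    at the kink evaluates the split innermost circle. *)
Lemma closure_circle n w : on_strands n.+1 w ->
  P (closure_link n.+2 w) = delta * P (closure_link n.+1 w).
Proof.
move=> wn; have wn' : on_strands n.+2 w by apply: sub_all wn => c /leqW.
have wc b : on_strands n.+2 (w ++ [:: (n, b)]).
  by rewrite /on_strands all_cat -/(on_strands n.+2 w) wn' /= !ltnS leqnn.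
have := @P_skein (cups n.+2 ++ word_layers n.+2 w) (caps n.+2)
  (nseq n.+2 false ++ nseq 0 true) (nseq n true)
  (closure_link n.+2 (w ++ [:: (n, true)])) (closure_link n.+2 (w ++ [:: (n, false)]))
  (closure_link n.+2 w).
rewrite !closure_linkE // /closed_word /word_layers !map_cat /up_crossing /= subnn -!catA.
move=> /(_ erefl erefl erefl).
rewrite !closure_stabilize // -mulrBl => e.
have vv : v - v^-1 != 0.
  by apply: contraNneq delta_neq0; rewrite deltaE => ->; rewrite invr0 mulr0.
apply: (mulfI vv); rewrite mulrA [_ * delta]mulrC deltaE divfK //.
by have := congr1 -%R e; rewrite -!mulNr !opprB.
Qed.

(** The closure of one strand is the unknot with the opposite orientation; the
    two are related by twisting a crossing onto the cup or off the cap. *)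
Lemma closure_unknot : P (closure_link 1 [::]) = delta.
Proof.
pose X : layer bool tangle := ([::], Crossing true true false, [::]).
have h1 : isotopic P [:: true; false] [:: X; ([::], Cap false, [::])]
    [:: ([::], Cap true, [::])] [::].
  by apply: isotopic_move => //; exact: (Reidemeister1Cap [::] true false [::]).
have h2 : isotopic P [::] [:: ([::], Cup true, [::]); X] [:: ([::], Cup false, [::])]
    [:: false; true].
  by apply: isotopic_move => //; exact: (Reidemeister1Cup [::] true true [::]).
have h : isotopic P [::] (closed_word 1 [::]) (link_layers unknot) [::].
  apply: (isotopic_trans (isotopic_sym (isotopic_catr (B := [:: ([::], Cap false, [::])]) h2 _))).
    by [].
  exact: (isotopic_catl (A := [:: ([::], Cup true, [::])]) _ h1).
rewrite -P_unknot.
by apply: (isotopicE h (u := [::]) (v := [::])); rewrite ?cats0 ?closure_linkE.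
Qed.

Definition word_weight (w : seq (nat * bool)) : K :=
  \prod_(c <- w) (if c.2 then - alpha^-1 else - alpha).

(** The least positive number of strands carrying the word: the empty link never
    has to be evaluated. *)
Definition strands (w : seq (nat * bool)) : nat := (\max_(c <- w) c.1.+1).+1.

Definition markov_trace (w : seq (nat * bool)) : K :=
  delta ^- strands w * word_weight w * P (closure_link (strands w) w).

Lemma on_strandsE n w : (0 < n)%N -> on_strands n w = (strands w <= n)%N.
Proof.
move=> n0; rewrite /strands; elim: w => [|c w IH] /=; first by rewrite big_nil n0.
by rewrite IH big_cons -maxnSS geq_max.
Qed.

(** The normalization by delta makes the value independent of the number of
    strands on which the word is closed. *)
Lemma markov_traceE n w : (0 < n)%N -> on_strands n w ->
  markov_trace w = delta ^- n * word_weight w * P (closure_link n w).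
Proof.
move=> n0; rewrite on_strandsE // => /subnK <-; rewrite addnC.
elim: (n - _)%N => [|k IH]; first by rewrite addn0.
have wk : on_strands (strands w + k) w by rewrite on_strandsE ?leq_addr.
have s0 : (0 < strands w + k)%N by [].
rewrite IH addnS exprSr; case: (strands w + k)%N s0 wk => // m _ wm.
rewrite (closure_circle wm) invfM -!mulrA; congr (_ * _).
by rewrite [RHS]mulrCA mulKf.
Qed.

Lemma on_strands_bound w : exists2 n, (0 < n)%N & on_strands n w.
Proof. by exists (strands w) => //; rewrite on_strandsE. Qed.

Lemma word_weight_cat u w : word_weight (u ++ w) = word_weight u * word_weight w.
Proof. exact: big_cat. Qed.

Lemma markov_trace_nil : markov_trace [::] = 1.
Proof.
rewrite (@markov_traceE 1) // closure_unknot /word_weight big_nil mulr1.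
by rewrite mulVf.
Qed.

Lemma markov_traceC u w : markov_trace (u ++ w) = markov_trace (w ++ u).
Proof.
elim: u w => [|c u IH] w; first by rewrite cats0.
rewrite -cat1s -cat_rcons -[in RHS]cats1 -[RHS]/(markov_trace ((w ++ [:: c]) ++ u)) -IH. 
have [n n0 cn] := on_strands_bound (c :: u ++ w).
have cn' : on_strands n ((u ++ w) ++ [:: c]).
  by move: cn; rewrite /on_strands all_cat /= andbT andbC.
rewrite catA (markov_traceE n0 cn') (@markov_traceE n (c :: u ++ w)) //.
rewrite closure_conjugate // word_weight_cat; congr (_ * _ * _).
by rewrite mulrC -word_weight_cat.
Qed.

Lemma markov_trace_isotopic x y u w :
    word_weight x = word_weight y -> (forall n, on_strands n x -> on_strands n y) ->
    (forall n, on_strands n x ->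
       isotopic P (updown n) (word_layers n x) (word_layers n y) (updown n)) ->
  markov_trace (u ++ x ++ w) = markov_trace (u ++ y ++ w).
Proof.
move=> xy nxy iso; have [n n0 un] := on_strands_bound (u ++ x ++ w).
have := un; rewrite {1}/on_strands !all_cat => /and3P[un' xn wn].
rewrite (markov_traceE n0 un) (markov_traceE n0 (w := u ++ y ++ w)); last first.
  by rewrite /on_strands !all_cat un' wn andbT; apply: nxy.
by rewrite (isotopic_closure un (nxy n xn) (iso n xn)) !word_weight_cat xy.
Qed.

Lemma markov_trace_skein u i w :
  markov_trace (u ++ (i, true) :: w) - markov_trace (u ++ (i, false) :: w)
  = (v - v^-1) * markov_trace (u ++ w).
Proof.
have [n n0 un] := on_strands_bound (u ++ (i, true) :: w).
have un' : on_strands n (u ++ (i, false) :: w).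
  by move: un; rewrite /on_strands !all_cat.
have un0 : on_strands n (u ++ w).
  by move: un; rewrite /on_strands !all_cat /= => /and3P[-> _ ->].
have := @P_skein (cups n ++ word_layers n u) (word_layers n w ++ caps n)
  (nseq n false ++ nseq (n - i.+2) true) (nseq i true)
  (closure_link n (u ++ (i, true) :: w)) (closure_link n (u ++ (i, false) :: w))
  (closure_link n (u ++ w)).
rewrite !closure_linkE // /closed_word /word_layers !map_cat /= -!catA /=.
move=> /(_ erefl erefl erefl) e.
rewrite (markov_traceE n0 un) (markov_traceE n0 un') (markov_traceE n0 un0).
rewrite !word_weight_cat /word_weight !big_cons /=.
transitivity (- (delta ^- n * word_weight u * word_weight w)
  * (alpha^-1 * P (closure_link n (u ++ (i, true) :: w))
     - alpha * P (closure_link n (u ++ (i, false) :: w)))).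
  by rewrite /word_weight; ring.
by rewrite e /word_weight; ring.
Qed.

Lemma markov_trace_stabilize n w : on_strands n.+1 w ->
  delta * markov_trace (w ++ [:: (n, true)]) = - alpha^-1 * markov_trace w.
Proof.
move=> wn; have wn' : on_strands n.+2 (w ++ [:: (n, true)]).
  have wn' : on_strands n.+2 w by apply: sub_all wn => c /leqW.
  by rewrite /on_strands all_cat -/(on_strands n.+2 w) wn' /= !ltnS leqnn.
rewrite (markov_traceE _ wn') // (markov_traceE _ wn) // closure_stabilize //.
rewrite word_weight_cat /word_weight big_seq1 /= exprS invfM.
by field; rewrite delta_neq0 expf_neq0 // alpha_neq0.
Qed.

(** * The Hecke algebra of a skein invariant *)

Variables (H : algType K) (tau : {scalar H}) (h : seq (nat * bool) -> H).
Hypotheses (h_nil : h [::] = 1) (h_cat : forall u w, h (u ++ w) = h u * h w).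
Hypothesis tau_h : forall w, tau (h w) = markov_trace w.
Hypothesis tau_eq : forall x y : H,
  (forall u w, tau (h u * x * h w) = tau (h u * y * h w)) -> x = y.

Definition hecke_T (i : nat) : H := h [:: (i, true)].

Lemma h_eq a b :
  (forall u w, markov_trace (u ++ a ++ w) = markov_trace (u ++ b ++ w)) ->
  h a = h b.
Proof.
by move=> ab; apply: tau_eq => u w; rewrite -!h_cat !tau_h -!catA.
Qed.

Lemma hecke_skein i :
  h [:: (i, false)] = hecke_T i - (v - v^-1)%:A.
Proof.
apply: tau_eq => u w; rewrite mulrBr mulrBl -scalerAr mulr1 -scalerAl.
rewrite -!h_cat linearB /= scalarZ !tau_h -!catA /=.
by rewrite -(markov_trace_skein u i w); ring.
Qed.

Lemma hecke_inverse i : hecke_T i * h [:: (i, false)] = 1.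
Proof.
rewrite -h_cat -h_nil; apply: h_eq => u w /=.
apply: (@markov_trace_isotopic [:: (i, true); (i, false)] [::]).
- by rewrite /word_weight !big_cons big_nil /= mulr1 mulrNN mulVf.
- by [].
- by move=> n /andP[/= ni _]; apply: up_inverse.
Qed.

Lemma hecke_quad i : hecke_T i * hecke_T i = 1 + (v - v^-1) *: hecke_T i.
Proof.
have := hecke_inverse i; rewrite hecke_skein mulrBr -scalerAr mulr1 => <-.
by rewrite subrK.
Qed.

Lemma hecke_braid i :
  hecke_T i * hecke_T i.+1 * hecke_T i = hecke_T i.+1 * hecke_T i * hecke_T i.+1.
Proof.
rewrite -!h_cat /=; apply: h_eq => u w; apply: markov_trace_isotopic.
- by rewrite /word_weight !big_cons big_nil.
- by move=> n /=; lia.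
- by move=> n /= nx; apply/isotopic_sym/up_braid => //; lia.
Qed.

Lemma hecke_comm i j : (i.+1 < j)%N -> GRing.comm (hecke_T i) (hecke_T j).
Proof.
move=> ij; rewrite /GRing.comm -!h_cat /=; apply: h_eq => u w.
apply: markov_trace_isotopic.
- by rewrite /word_weight !big_cons big_nil.
- by move=> n /=; lia.
- by move=> n /= nx; apply/isotopic_sym/up_up_exchange => //=; lia.
Qed.

Lemma tau_1 : tau 1 = 1.
Proof. by rewrite -h_nil tau_h markov_trace_nil. Qed.

(** The set of those y for which the formula holds with y w in place of x, for
    every word w below m, contains 1 and is stable under right multiplication by
    the elements generated below m. *)
Lemma hecke_markov m x : generated hecke_T m x ->
  delta * tau (x * hecke_T m) = - alpha^-1 * tau x.
Proof.
pose good y := forall w, on_strands m.+1 w ->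
  delta * tau (y * h w * hecke_T m) = - alpha^-1 * tau (y * h w).
have good1 : good 1.
  move=> w wm; rewrite mul1r -h_cat !tau_h.
  exact: markov_trace_stabilize.
have step : generated hecke_T m x -> forall y, good y -> good (y * x).
  elim=> {x} [|i im|c x _ IH|x x' _ IHx _ IHx'|x x' _ IHx _ IHx'] y gy.
  - by rewrite mulr1.
  - move=> w wm; rewrite -(mulrA y) -h_cat; apply: gy.
    by rewrite /= ltnS im.
  - move=> w wm; rewrite -scalerAr -!scalerAl !scalarZ mulrCA (IH _ gy) //.
    by rewrite mulrCA.
  - move=> w wm; rewrite mulrDr !mulrDl !linearD /= !mulrDr IHx // IHx' //.
  - by rewrite mulrA; apply: IHx'; apply: IHx.
move/step => /(_ 1 good1 [::] isT).
by rewrite mul1r h_nil mulr1.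
Qed.

Lemma hecke_letters w : h w = \prod_(c <- w) letter_elt v hecke_T c.
Proof.
elim: w => [|[i b] w IH]; first by rewrite h_nil big_nil.
rewrite big_cons -IH -cat1s h_cat; congr (_ * _).
by case: b; rewrite /letter_elt /= ?hecke_skein.
Qed.

(** * Values on closed braids *)

Lemma on_strands_letters N (beta : braid N) : on_strands N (letters beta).
Proof. by apply/allP => c /mapP[[i b] _ ->] /=; have := ltn_ord i; lia. Qed.

Lemma closed_word_letters N (beta : braid N) :
  closure_layers beta = closed_word N (letters beta).
Proof.
rewrite /closure_layers /closed_word; congr (_ ++ _ ++ _).
- elim: N {beta} => [|N IH] //; rewrite -addn1 iotaD map_cat IH /= addn1 //.
- rewrite /word_layers /letters -map_comp; apply: eq_map => -[i b].
  rewrite /up_crossing /=; congr (_ ++ nseq _ _, _, _); have := ltn_ord i; lia.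
- elim: N {beta} => [|N IH] //; rewrite -addn1 iotaD rev_cat map_cat IH /= addn1 //.
Qed.

Lemma word_weight_letters N (beta : braid N) :
  word_weight (letters beta) * ((-1) ^ writhe beta * alpha ^ writhe beta) = 1.
Proof.
have a0 : - alpha != 0 by rewrite oppr_eq0.
rewrite -expfzMl mulN1r.
elim: beta => [|[i b] beta IH]; first by rewrite /word_weight big_nil mul1r.
have -> : writhe ((i, b) :: beta) = (if b then 1 else -1) + writhe beta.
  by case: b; rewrite /writhe /=; lia.
rewrite expfzDr // /word_weight /= big_cons mulrACA -/(word_weight _) IH mulr1.
by case: b; rewrite /= ?expr1z ?mulrNN ?mulVf // exprN1 divff.
Qed.

Lemma braid_closure_trace N (beta : braid N) : (0 < N)%N ->
  P (braid_closure beta) = (-1) ^ writhe beta * alpha ^ writhe beta *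
    (delta ^+ N * tau (\prod_(c <- letters beta) letter_elt v hecke_T c)).
Proof.
move=> N0; have lN := on_strands_letters beta.
rewrite -hecke_letters tau_h (markov_traceE N0 lN).
rewrite -!mulrA mulVKf ?expf_neq0 // mulrA mulrCA mulrA word_weight_letters mul1r.
by congr P; apply: link_diagram_inj; rewrite closure_linkE //= closed_word_letters.
Qed.

End SkeinInvariant.

(** * Evaluation of skein invariants by circles *)

Lemma fraction_X_neq1 (R : idomainType) n : (tofrac 'X : {fraction {poly R}}) ^+ n.+1 != 1.
Proof.
rewrite -tofracXn -tofrac1 tofrac_eq; apply/eqP => /(congr1 (fun p : {poly R} => size p)).
by rewrite size_polyXn size_poly1.
Qed.

Lemma expr_subV_neq0 (K : fieldType) (x : K) n :
  x != 0 -> x ^+ (n + n) != 1 -> x ^+ n - x ^- n != 0.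
Proof.
move=> x0; apply: contraNneq => /eqP; rewrite subr_eq0 => /eqP e.
by rewrite exprD {1}e mulVf // expf_neq0.
Qed.

Lemma subV_neq0 (K : fieldType) (x : K) : x != 0 -> x ^+ 2 != 1 -> x - x^-1 != 0.
Proof. exact: (@expr_subV_neq0 K x 1). Qed.

Lemma q_exp_neq1 n : q ^+ n.+1 != 1. Proof. exact: fraction_X_neq1. Qed.
Lemma a_exp_neq1 n : a ^+ n.+1 != 1. Proof. exact: fraction_X_neq1. Qed.
Lemma a_neq0 : a != 0. Proof. by rewrite tofrac_eq0 polyX_eq0. Qed.

(** Both the polynomials of type sl_n and the HOMFLYPT polynomial are of this
    form, with alpha = q^n in Q(q) and alpha = a in Q(q)(a). *)
Theorem braid_closure_circles (K : fieldType) (f : {rmorphism Qq -> K}) (alpha : K)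
    (P : link_diagram -> K) N (beta : braid N) (C : circle_sum) :
    alpha != 0 -> alpha - alpha^-1 != 0 ->
    link_invariant P -> skein_relation alpha^-1 alpha (f (q^-1 - q)) P ->
    P unknot = (alpha - alpha^-1) / f (q - q^-1) ->
    (0 < N)%N -> annular_null (annular_bracket beta - circle_webs C) ->
  P (braid_closure beta) = (-1) ^ writhe beta * alpha ^ writhe beta
    * assign f (circle_value (f q) alpha) (qswap C).
Proof.
move=> alpha0 aa P_inv P_skein P_unknot N0 nullC; pose v := f q.
have v0 : v != 0 by rewrite fmorph_eq0 q_neq0.
have fvV : f q^-1 = v^-1 by rewrite fmorphV.
have vn n : v ^+ n.+1 != 1.
  by rewrite -(rmorph1 f) -rmorphXn (inj_eq (fmorph_inj f)) q_exp_neq1.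
have vv : v - v^-1 != 0 by apply: subV_neq0; rewrite ?vn.
have qn0 (k : nat) : qnum v k.+1 != 0.
  rewrite qnum.unlock -exprnN mulf_neq0 ?invr_eq0 //.
  by apply: expr_subV_neq0 => //; exact: vn.
rewrite !rmorphB fvV -/v in P_skein P_unknot.
set delta := (alpha - alpha^-1) / (v - v^-1) in P_unknot.
have deltaE : delta = (alpha - alpha^-1) / (v - v^-1) by [].
have delta0 : delta != 0 by rewrite mulf_neq0 ?invr_eq0.
move: delta deltaE delta0 P_unknot => delta deltaE delta0 P_unknot.
have [H [tau [h [h_nil h_cat tau_h tauC tau_eq]]]] :
    exists (H : algType K) (tau : {scalar H}) (h : seq (nat * bool) -> H),
    [/\ h [::] = 1, forall u w, h (u ++ w) = h u * h w,
        forall w, tau (h w) = markov_trace alpha delta P w,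
        forall x y : H, tau (x * y) = tau (y * x) &
        forall x y : H, (forall u w, tau (h u * x * h w) = tau (h u * y * h w)) -> x = y].
  apply: word_trace_algebra => [|u w]; last exact: (markov_traceC deltaE).
  by rewrite (markov_trace_nil deltaE) // oner_eq0.
have g_q : (f \o qbar) q = v^-1 by rewrite /= qbar_q.
rewrite (braid_closure_trace alpha0 deltaE delta0 P_inv P_skein h_nil h_cat tau_h tau_eq) //.
congr (_ * _).
have q2 := hecke_quad alpha0 deltaE delta0 P_inv P_skein h_nil h_cat tau_h tau_eq.
have qb := hecke_braid alpha0 deltaE delta0 P_inv P_skein h_cat tau_h tau_eq.
have qc := hecke_comm alpha0 deltaE delta0 P_inv P_skein h_cat tau_h tau_eq.
have qt := tau_1 deltaE delta0 P_inv P_skein P_unknot h_nil tau_h.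
have qm := hecke_markov alpha0 deltaE delta0 P_inv P_skein h_nil h_cat tau_h.
rewrite (braid_trace_circles v0 qn0 q2 qb qc g_q alpha0 delta0 deltaE tauC qt qm nullC).
rewrite -[assign _ _ _]/(mmap f (fun s => \prod_(k <- s) circle_value v alpha k) (qswap C)).
by rewrite /qswap raddf_sum /=; apply: eq_bigr => s _; rewrite mmapU.
Qed.

Lemma qbinom_circle n k : qbinom n k = circle_value q (q ^+ n) k.
Proof.
have w0 : q - q^-1 != 0 by apply: subV_neq0; [exact: q_neq0 | exact: q_exp_neq1].
rewrite /qbinom /circle_value; apply: eq_bigr => i _.
rewrite /qint opprB !expfzDr ?q_neq0 // -!exprnN -!exprnP.
rewrite invfM invrK mulrACA mulVf // mulr1; congr (_ / _).
by rewrite [q ^+ i * _]mulrC.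
Qed.

Lemma circle_value_product (K : fieldType) (v x : K) k :
    v != 0 -> x != 0 -> (forall n, v ^+ n.+1 != 1) ->
  v ^+ (k ^ 2) * x ^- k *
    \prod_(1 <= i < k.+1) ((1 - x ^+ 2 * v ^ (2 - (2 * i)%:Z)) / (1 - v ^+ (2 * i)))
  = circle_value v x k.
Proof.
move=> v0 x0 vn.
elim: k => [|k IH]; first by rewrite big_geq // /circle_value big_ord0 exp0n // !expr0 invr1 !mulr1.
rewrite big_nat_recr //= /circle_value big_ord_recr /= -/(circle_value v x k) -IH.
have -> : (k.+1 ^ 2 = k ^ 2 + k + k.+1)%N by lia.
have -> : (2 - (2 * k.+1)%N%:Z) = - (k + k)%N%:Z by lia.
have d1 : 1 - v ^+ (2 * k.+1) != 0 by rewrite subr_eq0 eq_sym mul2n -addnn vn.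
have -> : (v ^+ k.+1 - v ^- k.+1) = - (1 - v ^+ (2 * k.+1)) / v ^+ k.+1.
  by rewrite mul2n -addnn exprD; field; rewrite expf_neq0.
move: (v ^+ (2 * k.+1)) d1 (\prod_(1 <= i < k.+1) _) => e d1 b.
rewrite -exprnN !exprD !exprS.
by field; rewrite oppr_eq0 d1 v0 x0 !expf_neq0.
Qed.

Lemma c_wedge_circle k : c_wedge k = circle_value (toQqa q) a k.
Proof.
apply: circle_value_product; [by rewrite fmorph_eq0 q_neq0|exact: a_neq0|] => n.
by rewrite -(rmorph1 toQqa) -rmorphXn (inj_eq (fmorph_inj toQqa)) q_exp_neq1.
Qed.

Lemma eq_assign (K : fieldType) (f : Qq -> K) val val' C :
  val =1 val' -> assign f val C = assign f val' C.
Proof. by move=> e; apply: eq_bigr => s _; congr (_ * _); apply: eq_bigr. Qed.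

Theorem proposition1p5 (N : nat) (hN : (0 < N)%N) (beta : braid N)
    (C : circle_sum) (hC : is_circle_expression beta C) :
  (forall (n : nat) (P : link_diagram -> Qq),
     (1 <= n)%N -> is_sln_polynomial n P ->
     P (braid_closure beta) =
       (-1) ^ writhe beta * q ^ (n%:Z * writhe beta)
       * assign id (qbinom n) (qswap C))
  /\
  (forall P : link_diagram -> Qqa,
     is_homflypt P ->
     P (braid_closure beta) =
       (-1) ^ writhe beta * a ^ writhe beta
       * assign toQqa c_wedge (qswap C)).
Proof.
case: hC => _ _ nullC.
split=> [[|n] P // _ [P_inv P_skein P_unknot]|P [P_inv P_skein P_unknot]].
  rewrite (eq_assign _ _ (qbinom_circle n.+1)) -exprz_exp -exprnP.
  apply: (@braid_closure_circles Qq idfun) => //.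
  - by rewrite expf_neq0 ?q_neq0.
  - by apply: expr_subV_neq0; [exact: q_neq0 | rewrite addnS; exact: q_exp_neq1].
rewrite (eq_assign _ _ c_wedge_circle).
apply: (@braid_closure_circles Qqa toQqa) => //.
- exact: a_neq0.
- by apply: subV_neq0; [exact: a_neq0 | exact: a_exp_neq1].
Qed.
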